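(* Let $M_1,M_2$ be two loopless matroids of rank $r+1$ on $n+1$ elements. Then $\mathcal{G}(M_1)=\mathcal{G}(M_2)$ if and only if for every sequence of nonnegative integers $a_1,\ldots,a_n$ with $\sum_{i=1}^n a_i=r$ we have $$A_{M_1}(a_1,\ldots,a_n)=A_{M_2}(a_1,\ldots,a_n).$$
   Context: Take the ground set to be $[n]=\{0,1,\dots,n\}$. Derksen's $\mathcal{G}$-invariant: an $(n+1,r+1)$-sequence is a sequence $[\underline{r}]=(r_0,\dots,r_n)\in\{0,1\}^{n+1}$ with exactly $r+1$ ones. For a matroid $M$ of rank $r+1$ on $[n]$ and a permutation $\sigma\in\mathfrak{S}_{n+1}$ of $[n]$, let $[\underline{r(\sigma)}]$ be the $(n+1,r+1)$-sequence with $r_0=\mathrm{rk}_M(\{\sigma(0)\})$ and $r_j=\mathrm{rk}_M(\{\sigma(0),\ldots,\sigma(j)\})-\mathrm{rk}_M(\{\sigma(0),\ldots,\sigma(j-1)\})$ for $j=1,\dots,n$. Then $\mathcal{G}(M)=\sum_{\sigma\in\mathfrak{S}_{n+1}}[\underline{r(\sigma)}]$, an element of the free abelian group on the $(n+1,r+1)$-sequences. Matroidal mixed Eulerian numbers: let $\mathrm{CH}(X_{\Pi_n},\mathbb{Q})=\mathbb{Q}[x_S:\emptyset\subsetneq S\subsetneq[n]]/(I_l+I_q)$ be the Chow ring of the permutohedral variety, where $I_q$ is generated by $x_Sx_T$ for inclusion-incomparable $S,T$ and $I_l$ by $\sum_{S\ni a}x_S-\sum_{S\ni b}x_S$ for $a,b\in[n]$.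 The degree map $\int_{X_{\Pi_n}}:\mathrm{CH}^n\to\mathbb{Q}$ is the isomorphism sending $x_{F_1}\cdots x_{F_n}$ to $1$ for every complete chain $\emptyset\subsetneq F_1\subsetneq\dots\subsetneq F_n\subsetneq[n]$. For $1\le i\le n$, $L_i=\sum_{S}c_{i,S}\,x_S$ with $c_{i,S}=\min(n+1-i,|S|)$ if $n\notin S$ and $c_{i,S}=\min(n+1-i,|S|)-(n+1-i)$ if $n\in S$. For a loopless matroid $M$ on $[n]$ of rank $r+1$, $[X_M]\in\mathrm{CH}^{n-r}(X_{\Pi_n},\mathbb{Q})$ is the unique class such that, for every chain $\emptyset\subsetneq F_1\subsetneq\dots\subsetneq F_r\subsetneq[n]$, $\int[X_M]x_{F_1}\cdots x_{F_r}$ equals $1$ if all $F_i$ are flats of $M$ and $0$ otherwise. Then $A_M(a_1,\dots,a_n)=\int_{X_{\Pi_n}}[X_M]L_1^{a_1}\cdots L_n^{a_n}$. *)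

(* Defs.v *)
From HB Require Import structures.
From Stdlib Require Import ClassicalEpsilon.
From mathcomp Require Import all_boot all_order all_algebra all_fingroup.
From mathcomp Require Import mpoly freeg.

Set Implicit Arguments.
Unset Strict Implicit.
Unset Printing Implicit Defensive.

Import GRing.Theory.
Local Open Scope ring_scope.

(* Rank-function axiomatization; [k] is the rank of the matroid, [E] its
   ground set. *)
Record matroid (E : finType) (k : nat) := Matroid {
  rk :> {set E} -> nat;
  rk_le_card : forall A : {set E}, (rk A <= #|A|)%N;
  rk_mono : forall A B : {set E}, A \subset B -> (rk A <= rk B)%N;
  rk_submod : forall A B : {set E},
    (rk (A :|: B) + rk (A :&: B) <= rk A + rk B)%N;
  rk_setT : rk [set: E] = k
}.

Section MatroidTheory.
Variables (E : finType) (k : nat) (M : matroid E k).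

Definition loopless : Prop := forall e : E, M [set e] = 1%N.

Definition flat (F : {set E}) : bool :=
  [forall e in ~: F, M F < M (e |: F)]%N.

Lemma matroid_rk0 : M set0 = 0%N.
Proof. by have := rk_le_card M set0; rewrite cards0 leqn0 => /eqP. Qed.

Lemma rk_setU1 (e : E) (A : {set E}) : (M (e |: A) <= (M A).+1)%N.
Proof.
have h := rk_submod M [set e] A.
have h1 := rk_le_card M [set e]; rewrite cards1 in h1.
rewrite -add1n; apply: leq_trans (leq_trans (leq_addr _ _) h) _.
by rewrite leq_add2r.
Qed.

End MatroidTheory.

Section GInvariant.

Definition is_01_seq (m k : nat) (s : m.-tuple nat) : bool :=
  all (fun x => x <= 1)%N s && (count_mem 1%N s == k).

Definition seq01 (m k : nat) := {s : m.-tuple nat | is_01_seq k s}.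

Variables (n k : nat) (M : matroid 'I_n.+1 k).

(* {s(0), ..., s(j-1)} *)
Definition prefix (s : 'S_n.+1) (j : nat) : {set 'I_n.+1} :=
  [set s i | i : 'I_n.+1 & (i < j)%N].

Definition rank_jumps (s : 'S_n.+1) : n.+1.-tuple nat :=
  [tuple (M (prefix s j.+1) - M (prefix s j))%N | j < n.+1].

Lemma prefix0 (s : 'S_n.+1) : prefix s 0 = set0.
Proof. by apply/setP=> x; rewrite inE; apply/negP => /imsetP [i]; rewrite inE. Qed.

Lemma prefixS (s : 'S_n.+1) (j : 'I_n.+1) :
  prefix s j.+1 = s j |: prefix s j.
Proof.
apply/setP=> x; rewrite !inE -[x](permKV s) (inj_eq perm_inj).
rewrite !(mem_imset _ _ perm_inj) !inE ltnS leq_eqVlt.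
by rewrite -(inj_eq val_inj).
Qed.

Lemma prefix_full (s : 'S_n.+1) : prefix s n.+1 = setT.
Proof.
apply/setP=> x; rewrite !inE -[x](permKV s) (mem_imset _ _ perm_inj) inE.
exact: ltn_ord.
Qed.

Lemma prefix_mono (s : 'S_n.+1) (i j : nat) :
  (i <= j)%N -> prefix s i \subset prefix s j.
Proof.
move=> le_ij; apply/subsetP=> x /imsetP [y]; rewrite inE => lt_yi ->.
by rewrite (mem_imset _ _ perm_inj) inE (leq_trans lt_yi).
Qed.

Lemma rank_jumps_01 (s : 'S_n.+1) : is_01_seq k (rank_jumps s).
Proof.
have le1 (j : 'I_n.+1) : (M (prefix s j.+1) - M (prefix s j) <= 1)%N.
  by rewrite leq_subLR addn1 prefixS rk_setU1.
apply/andP; split.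
  by apply/allP=> x /tnthP [j ->]; rewrite tnth_mktuple.
rewrite -(rk_setT M) -(prefix_full s) -sum1_count big_tuple.
rewrite (eq_bigl (fun j : 'I_n.+1 =>
  (M (prefix s j.+1) - M (prefix s j))%N == 1%N)); last first.
  by move=> j; rewrite tnth_mktuple.
rewrite big_mkcond /=.
rewrite (eq_bigr (fun j : 'I_n.+1 =>
  (M (prefix s j.+1) - M (prefix s j))%N)); last first.
  by move=> j _; case: (_ - _)%N (le1 j) => [|[|]].
rewrite -(big_mkord xpredT (fun j => (M (prefix s j.+1) - M (prefix s j))%N)).
rewrite telescope_sumn_in //; first by rewrite prefix0 matroid_rk0 subn0.
by move=> i _; apply: rk_mono; apply: prefix_mono.
Qed.

Definition rank_seq (s : 'S_n.+1) : seq01 n.+1 k :=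
  Sub (rank_jumps s) (rank_jumps_01 s).

Definition G_invariant : {freeg (seq01 n.+1 k)} :=
  \sum_(s : 'S_n.+1) [freeg [:: (1, rank_seq s)]].

End GInvariant.

Section ChowRing.
Variable n : nat.

Definition psub := {S : {set 'I_n.+1} | (S != set0) && (S != [set: 'I_n.+1])}.

Local Notation chow_poly := {mpoly rat[#|{: psub}|]}.

Definition xvar (S : psub) : chow_poly := 'X_(enum_rank S).

Definition incomparable (S T : psub) : Prop :=
  ~~ (val S \subset val T) /\ ~~ (val T \subset val S).

(* The ideal I_l + I_q. *)
Inductive chow_ideal : chow_poly -> Prop :=
| chow_lin (a b : 'I_n.+1) :
    chow_ideal (\sum_(S : psub | a \in val S) xvar S
                - \sum_(S : psub | b \in val S) xvar S)
| chow_quad (S T : psub) : incomparable S T -> chow_ideal (xvar S * xvar T)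
| chow_zero : chow_ideal 0
| chow_add (p q : chow_poly) :
    chow_ideal p -> chow_ideal q -> chow_ideal (p + q)
| chow_mul (p q : chow_poly) : chow_ideal q -> chow_ideal (p * q).

Definition chow_idealb : {pred chow_poly} :=
  fun p => if excluded_middle_informative (chow_ideal p) then true else false.

Lemma chow_idealP (p : chow_poly) : reflect (chow_ideal p) (p \in chow_idealb).
Proof.
rewrite unfold_in /chow_idealb.
by case: excluded_middle_informative => h; constructor.
Qed.

Lemma chow_ideal_eval0 (p : chow_poly) : chow_ideal p -> p.@[fun=> 0] = 0.
Proof.
have x0 (S : psub) : (xvar S).@[fun=> 0] = 0 by rewrite /xvar mevalXU.
elim=> [a b|S T _||q1 q2 _ h1 _ h2|q1 q2 _ h].
- rewrite mevalB !(raddf_sum (meval (fun=> 0))).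
  by rewrite !big1 ?subr0 // => S _; apply: x0.
- by rewrite mevalM x0 mul0r.
- by rewrite meval0.
- by rewrite mevalD h1 h2 addr0.
- by rewrite mevalM h mulr0.
Qed.

Lemma chow_idealr_closed : idealr_closed chow_idealb.
Proof.
split; first by apply/chow_idealP; apply: chow_zero.
  apply/chow_idealP => /chow_ideal_eval0 /eqP.
  by rewrite meval1 oner_eq0.
move=> c p q /chow_idealP hp /chow_idealP hq; apply/chow_idealP.
by apply: chow_add => //; apply: chow_mul.
Qed.

HB.instance Definition _ := isIdealr.Build chow_poly chow_idealb chow_idealr_closed.

Definition chow := {ideal_quot chow_idealb}.
HB.instance Definition _ := GRing.ComNzRing.on chow.

Definition chow_class (p : chow_poly) : chow := (\pi_{ideal_quot chow_idealb} p)%qT.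

Definition x_ (S : psub) : chow := chow_class (xvar S).

Definition chow_scale (c : rat) (x : chow) : chow := chow_class c%:MP * x.

(* Membership in the graded piece CH^k. *)
Definition chow_graded (k : nat) (x : chow) : Prop :=
  exists2 p : chow_poly, p \is k.-homog & x = chow_class p.

Definition is_chain (F : seq psub) : bool :=
  sorted (fun S T : psub => val S \proper val T) F.

Definition chow_monomial (F : seq psub) : chow := \prod_(S <- F) x_ S.

(* Only the restriction of [d] to CH^n is constrained: it is a linear
   isomorphism onto rat with value 1 on the complete chains. *)
Definition is_degree_map (d : chow -> rat) : Prop :=
  [/\ forall (c : rat) (x y : chow), chow_graded n x -> chow_graded n y ->
        d (chow_scale c x + y) = c * d x + d y,
      forall x y : chow, chow_graded n x -> chow_graded n y ->
        d x = d y -> x = y,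
      forall q : rat, exists2 x : chow, chow_graded n x & d x = q
    & forall F : n.-tuple psub, is_chain F -> d (chow_monomial F) = 1].

Definition degree_map : chow -> rat :=
  epsilon (inhabits (fun=> 0)) is_degree_map.

(* L_i, for 1 <= i <= n; the element n of the ground set {0, ..., n} is
   [ord_max]. *)
Definition Lcoef (i : nat) (S : psub) : rat :=
  (minn (n.+1 - i) #|val S|)%:R
  - (if ord_max \in val S then (n.+1 - i)%:R else 0).

Definition L_ (i : nat) : chow := \sum_(S : psub) chow_scale (Lcoef i S) (x_ S).

End ChowRing.

Section MixedEulerian.
Variables (n r : nat) (M : matroid 'I_n.+1 r.+1).

Definition is_matroid_class (X : chow n) : Prop :=
  chow_graded (n - r) X /\
  forall F : r.-tuple (psub n), is_chain F ->
    degree_map (X * chow_monomial F)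
    = (if all (fun S : psub n => flat M (val S)) F then 1 else 0).

Definition matroid_class : chow n := epsilon (inhabits 0) is_matroid_class.

(* A_M(a_1, ..., a_n), where a_i is the value of [a] at the index i-1. *)
Definition mixed_eulerian (a : 'I_n -> nat) : rat :=
  degree_map (matroid_class * \prod_(i < n) L_ n i.+1 ^+ a i).

End MixedEulerian.

(* Main.v *)
(* Let y_k be the sum of the x_S with |S| = k.  The classes L_i and y_k span the
   same space: up to linear relations, y_k is the second difference of the L_i
   at i = n+1-k.  Since moreover y_k L_{n+1-k} = 0 (Klyachko), interpolating
   linearly between the indices in a set K rewrites every product of y_K and some
   L_i as a combination of squarefree monomials in the y_k.  Hence the mixed
   Eulerian numbers of M carry the same information as the degrees of
   [X_M] y_{k_1} ... y_{k_r} with k_1 < ... < k_r, which count the complete flags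
   of proper flats of M with these cardinalities.  The rank sequence of a
   permutation determines, together with the permutation, such a flag (the
   closures of the prefixes), and the number of permutations giving a fixed flag
   and a fixed rank sequence depends only on the cardinalities in the flag, in a
   triangular fashion; so these flag counts are also equivalent to G(M).
   The degree map exists by localization at the torus-fixed points, and [X_M] is
   a product of divisors, one for each step of a chain of elementary quotients
   (Higgs lifts) leading from the Boolean matroid to M. *)

From HB Require Import structures.
From Stdlib Require Import ClassicalEpsilon.
Require Import Defs.
From mathcomp Require Import all_boot all_order all_algebra.
From mathcomp Require Import all_fingroup mpoly freeg ring zify.

Set Implicit Arguments.
Unset Strict Implicit.
Unset Printing Implicit Defensive.

Import Order.TTheory GRing.Theory Num.Theory.
Local Open Scope ring_scope.

(** * Chains of subsets *)

Section Chains.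
Variable n : nat.
Implicit Types (S T U : psub n) (G : {set psub n}) (w : 'S_n.+1).

Definition nested S T := (val S \subset val T) || (val T \subset val S).
Definition chain_set G := [forall S in G, forall T in G, nested S T].

Lemma chain_setP G :
  reflect {in G &, forall S T, nested S T} (chain_set G).
Proof.
apply: (iffP forall_inP) => h; first by move=> S T hS hT; apply: (forall_inP (h S hS)).
by move=> S hS; apply/forall_inP => T hT; apply: h.
Qed.

Lemma nestedxx S : nested S S.
Proof. by rewrite /nested subxx. Qed.

Lemma nestedC S T : nested S T = nested T S.
Proof. by rewrite /nested orbC. Qed.

Lemma chain_setU1 S G :
  chain_set (S |: G) = chain_set G && [forall T in G, nested S T].
Proof.
apply/chain_setP/andP => [h|[/chain_setP h /forall_inP h']].
  split; first by apply/chain_setP => T U hT hU; apply: h; rewrite !inE ?hT ?hU orbT.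
  by apply/forall_inP => T hT; apply: h; rewrite !inE ?eqxx ?hT ?orbT.
move=> T U; rewrite !inE => /predU1P[->|hT] /predU1P[->|hU].
- exact: nestedxx.
- exact: h'.
- by rewrite nestedC h'.
- exact: h.
Qed.

Lemma psub_gt0 S : (0 < #|val S|)%N.
Proof. by rewrite card_gt0; case: S => ? /= /andP[]. Qed.

Lemma psub_ltn S : (#|val S| < n.+1)%N.
Proof.
have : val S \proper setT by rewrite properT; case: S => ? /= /andP[].
by move/proper_card; rewrite cardsT card_ord.
Qed.

Lemma chain_sub_card G S T : chain_set G -> S \in G -> T \in G ->
  (#|val S| <= #|val T|)%N -> val S \subset val T.
Proof.
move=> /chain_setP h hS hT le; have /orP[//|h2] := h _ _ hS hT.
have /eqP -> : val T == val S by rewrite eqEcard h2.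
exact: subxx.
Qed.

Lemma chain_card_inj G : chain_set G ->
  {in G &, injective (fun S => #|val S|)}.
Proof.
move=> cG S T hS hT /= eqST; apply: val_inj; apply/eqP; rewrite eqEsubset.
by rewrite !(chain_sub_card cG) ?eqST.
Qed.

Lemma chain_separate G (p : pred (psub n)) : chain_set G ->
    {in G &, forall S T, val S \subset val T -> p S -> p T} ->
  exists a : 'I_n.+1, {in G, forall S, (a \in val S) = p S}.
Proof.
move=> cG up.
have [U hU U_max] : exists2 U : {set 'I_n.+1},
    {in G, forall S, ~~ p S -> val S \subset U} &
    U = set0 \/ exists S, [/\ S \in G, ~~ p S & U = val S].
  case: (pickP [pred S in G | ~~ p S]) => [S0 hS0|none].
    case: (arg_maxnP (fun S => #|val S|) hS0) => S1 /andP[hS1 pS1] max1.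
    exists (val S1) => [S hS pS|]; last by right; exists S1.
    by apply: (chain_sub_card cG) => //; apply: max1; rewrite inE hS.
  by exists set0 => [S hS pS|]; [have := none S; rewrite inE hS pS | left].
have [V hV V_min] : exists2 V : {set 'I_n.+1},
    {in G, forall S, p S -> V \subset val S} &
    V = setT \/ exists S, [/\ S \in G, p S & V = val S].
  case: (pickP [pred S in G | p S]) => [S0 hS0|none].
    case: (arg_minnP (fun S => #|val S|) hS0) => S1 /andP[hS1 pS1] min1.
    exists (val S1) => [S hS pS|]; last by right; exists S1.
    by apply: (chain_sub_card cG) => //; apply: min1; rewrite inE hS.
  by exists setT => [S hS pS|]; [have := none S; rewrite inE hS pS | left].
have : ~~ (V \subset U).
  case: U_max V_min => [->|[S [hS pS ->]]] [->|[T [hT pT ->]]].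
  - by rewrite subset0 -card_gt0 cardsT card_ord.
  - by rewrite subset0; case: T {hT pT} => ? /= /andP[].
  - by rewrite subTset; case: S {hS pS} => ? /= /andP[].
  - by apply: contra pS => sTS; apply: (up T).
case/subsetPn=> a aV aU; exists a => S hS.
apply/idP/idP => [aS|pS]; last by apply: (subsetP (hV _ hS pS)).
by apply: contraR aU => pS; apply: (subsetP (hU _ hS pS)).
Qed.

Lemma in_prefix w k x : (x \in Defs.prefix w k) = (w^-1%g x < k)%N.
Proof. by rewrite -{1}[x](permKV w) (mem_imset _ _ perm_inj) inE. Qed.

Lemma card_prefix w k : (k <= n.+1)%N -> #|Defs.prefix w k| = k.
Proof.
move=> le_kn; rewrite card_imset; last exact: perm_inj.
rewrite -sum1dep_card (eq_bigl (fun i : 'I_n.+1 => (i < k)%N)) //.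
by rewrite -(big_ord_widen _ (fun=> 1%N)) // sum1_card card_ord.
Qed.

Lemma prefix_perm_inj w w' :
  (forall k, (0 < k < n.+1)%N -> Defs.prefix w k = Defs.prefix w' k) -> w = w'.
Proof.
move=> h; have {}h k : Defs.prefix w k = Defs.prefix w' k.
  have [->|k0] := posnP k; first by rewrite !prefix0.
  have [lt|ge] := ltnP k n.+1; first by rewrite h ?k0.
  by apply/setP => x; rewrite !in_prefix !(leq_trans (ltn_ord _)).
apply: invg_inj; apply/permP => x; apply: val_inj => /=.
have eq_lt k : (w^-1%g x < k)%N = (w'^-1%g x < k)%N by rewrite -!in_prefix h.
by apply/eqP; rewrite eqn_leq -ltnS eq_lt ltnSn -[(_ <= _)%N]ltnS -eq_lt ltnSn.
Qed.

Lemma chain_perm G : chain_set G ->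
  exists w, {in G, forall S, Defs.prefix w #|val S| = val S}.
Proof.
move=> /chain_setP cG.
pose level x := #|[set S in G | x \notin val S]|.
have level_lt S x y : S \in G -> x \in val S -> y \notin val S -> (level x < level y)%N.
  move=> hS xS yS; apply: proper_card; apply/properP; split.
    apply/subsetP => T; rewrite !inE => /andP[hT xT]; rewrite hT /=.
    apply: contra xT => yT; have /orP[/subsetP->//|/subsetP sTS] := cG _ _ hS hT.
    by rewrite sTS in yS.
  by exists S; rewrite !inE hS ?xS ?yS.
pose le x y := (level x <= level y)%N.
pose l := sort le (enum 'I_n.+1).
have size_l : size l = n.+1 by rewrite size_sort size_enum_ord.
have uniq_l : uniq l by rewrite sort_uniq enum_uniq.
have mem_l x : x \in l by rewrite mem_sort mem_enum.
have sorted_l : sorted le l by apply: sort_sorted => x y; apply: leq_total.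
have f_inj : injective (fun i : 'I_n.+1 => nth ord0 l i).
  by move=> i j /eqP; rewrite nth_uniq ?size_l // => /eqP /val_inj.
exists (perm f_inj) => S hS; set w := perm _.
have wE i : w i = nth ord0 l i by rewrite permE.
have wV x : (w^-1%g x : nat) = index x l.
  by rewrite -[in RHS](permKV w x) wE index_uniq ?size_l.
apply/esym/eqP; rewrite eqEcard card_prefix ?leqnn ?andbT ?(ltnW (psub_ltn S)) //.
apply/subsetP => x xS; rewrite in_prefix wV.
have lt_x : (index x l < n.+1)%N by rewrite -[X in (_ < X)%N]size_l index_mem.
rewrite -(card_prefix w lt_x); apply: subset_leq_card; apply/subsetP => y.
rewrite in_prefix wV ltnS => le_yx; apply: contraLR (xS) => yS; apply/negP => _.
have := level_lt _ _ _ hS xS yS; rewrite ltnNge -/(le y x) => /negP; apply.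
rewrite -(nth_index ord0 (mem_l y)) -(nth_index ord0 (mem_l x)).
apply: (sorted_leq_nth _ _ _ sorted_l) => //; rewrite ?inE ?index_mem //.
  by move=> a b c; apply: leq_trans.
by move=> a; apply: leqnn.
Qed.

End Chains.

(** * The degree map *)

Section Straightening.
Variable n : nat.
Implicit Types (S T U : psub n) (G : {set psub n}) (w : 'S_n.+1) (s : seq (psub n)).

Local Notation chow_poly := {mpoly rat[#|{: psub n}|]}.

Definition lin_rel (a b : 'I_n.+1) : chow_poly :=
  \sum_(S : psub n | a \in val S) xvar S - \sum_(S : psub n | b \in val S) xvar S.

Lemma incomparableP S T : incomparable S T <-> ~~ nested S T.
Proof. by rewrite /nested negb_or; split=> [[-> ->]|/andP]. Qed.

Lemma lin_relE a b : lin_rel a b =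
  \sum_(S : psub n | (a \in val S) && (b \notin val S)) xvar S
  - \sum_(S : psub n | (b \in val S) && (a \notin val S)) xvar S.
Proof.
rewrite /lin_rel (bigID (fun S : psub n => b \in val S)) /=.
rewrite [X in _ - X](bigID (fun S : psub n => a \in val S)) /=.
rewrite [X in _ - (X + _)](eq_bigl (fun S : psub n => (a \in val S) && (b \in val S))).
  by ring.
by move=> S; rewrite andbC.
Qed.

Lemma prod_setU1 (R : comNzRingType) (F : psub n -> R) S G : S \notin G ->
  \prod_(T in S |: G) F T = F S * \prod_(T in G) F T.
Proof. by move=> hS; rewrite big_setU1. Qed.

(* A repeated factor x_S of a chain monomial is removed by the linear relation for
   a, b such that S is the only member of the chain containing a but not b. *)
Lemma straightening (P : chow_poly -> Prop) (m : nat) :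
    (forall p q, P p -> P q -> P (p + q)) ->
    (forall p, P p -> P (- p)) ->
    (forall p S T, incomparable S T -> P (p * (xvar S * xvar T))) ->
    (forall s a b, (size s).+1 = m -> P (\prod_(S <- s) xvar S * lin_rel a b)) ->
    (forall G, chain_set G -> #|G| = m -> P (\prod_(S in G) xvar S)) ->
  forall s, size s = m -> P (\prod_(S <- s) xvar S).
Proof.
move=> Padd Popp Pquad Plin Pchain.
suff main s G : chain_set G -> (#|G| + size s)%N = m ->
    P (\prod_(S in G) xvar S * \prod_(S <- s) xvar S).
  move=> s size_s; have := main s set0; rewrite big_set0 mul1r cards0; apply => //.
  by apply/chain_setP => S T; rewrite inE.
elim: s G => [|S s IHs] G cG; first by rewrite big_nil mulr1 addn0; apply: Pchain.
rewrite /= addnS => size_s.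
have add_new T : T \notin G ->
    P (\prod_(U in G) xvar U * \prod_(U <- s) xvar U * xvar T).
  move=> hT; have [nest|] := boolP [forall U in G, nested T U].
    rewrite mulrAC [_ * xvar T]mulrC -prod_setU1 //; apply: IHs.
      by rewrite chain_setU1 cG.
    by rewrite cardsU1 hT add1n addSn.
  case/forall_inPn => U hU /incomparableP nTU.
  rewrite (bigD1 U) //=.
  set A := \prod_(_ | _) _; set B := \prod_(_ <- _) _.
  have -> : xvar U * A * B * xvar T = A * B * (xvar T * xvar U) by ring.
  exact: Pquad.
rewrite big_cons [xvar S * _]mulrC mulrA.
have [hS|] := boolP (S \in G); last exact: add_new.
have [a ha] := chain_separate (p := fun T => val S \subset val T) cG
  (fun T U _ _ sTU sST => subset_trans sST sTU).
have [b hb] : exists b : 'I_n.+1, {in G, forall T, (b \in val T) = (val S \proper val T)}.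
  by apply: chain_separate cG _ => T U _ _ sTU pST; apply: proper_sub_trans sTU.
set Q := \prod_(_ in _) _ * \prod_(_ <- _) _.
have -> : Q * xvar S = Q * lin_rel a b
    - \sum_(T : psub n | (a \in val T) && (b \notin val T) && (T != S)) Q * xvar T
    + \sum_(T : psub n | (b \in val T) && (a \notin val T)) Q * xvar T.
  rewrite lin_relE (bigD1 S) /=; last by rewrite ha // hb // subxx properxx.
  by rewrite -!mulr_sumr; ring.
have Psum (p : pred (psub n)) : (forall T, p T -> T \notin G) ->
    P (\sum_(T | p T) Q * xvar T).
  move=> hp; rewrite -big_filter; have : all [predC G] [seq T <- index_enum (psub n) | p T].
    by apply/allP => T; rewrite mem_filter => /andP[/hp].
  elim: [seq _ <- _ | _] => [_|T l IHl /= /andP[hT hl]].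
    rewrite big_nil -[0](subrr (Q * lin_rel a b)).
    suff PQ : P (Q * lin_rel a b) by apply: Padd => //; apply: Popp.
    rewrite /Q -[\prod_(_ in _) _]big_enum -big_cat; apply: Plin.
    by rewrite size_cat -cardE.
  by rewrite big_cons; apply: Padd; [apply: add_new | apply: IHl].
apply: (Padd _ _ (Padd _ _ _ (Popp _ _))).
- rewrite /Q -[\prod_(_ in _) _]big_enum -big_cat; apply: Plin.
  by rewrite size_cat -cardE.
- apply: Psum => T /andP[/andP[aT bT] nTS]; apply: contra bT => hT.
  by rewrite hb // properEneq -ha // aT andbT eq_sym.
apply: Psum => T /andP[bT aT]; apply: contra aT => hT.
by rewrite ha //; move: bT; rewrite hb // => /proper_sub.
Qed.

End Straightening.

Section Localization.
Variable n : nat.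
Implicit Types (S T U : psub n) (G : {set psub n}) (w : 'S_n.+1) (s : seq (psub n)).

Local Notation chow_poly := {mpoly rat[#|{: psub n}|]}.

Lemma prefix_psub_subproof w k : (0 < k < n.+1)%N ->
  (Defs.prefix w k != set0) && (Defs.prefix w k != setT).
Proof.
case/andP=> k0 kn; rewrite -card_gt0 card_prefix ?(ltnW kn) // k0 /=.
by apply/eqP => h; have := card_prefix w (ltnW kn); rewrite h cardsT card_ord; lia.
Qed.

Definition prefix_psub w k (hk : (0 < k < n.+1)%N) : psub n :=
  Sub (Defs.prefix w k) (prefix_psub_subproof w hk).

Definition edge w k : rat := (w (inord k.-1))%:R - (w (inord k))%:R.

Definition localize w S : rat :=
  if Defs.prefix w #|val S| == val S then edge w #|val S| else 0.

Definition local_eval w (p : chow_poly) : rat :=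
  p.@[fun i => localize w (enum_val i)].

(* Localization formula with equivariant parameters t_a = a.  It is compatible with
   the linear relations only up to the factor t_a - t_b, see [local_deg_lin]. *)
Definition local_deg (p : chow_poly) : rat :=
  \sum_w local_eval w p / \prod_(1 <= k < n.+1) edge w k.

Lemma local_eval_x w S : local_eval w (xvar S) = localize w S.
Proof. by rewrite /local_eval /xvar mevalXU enum_rankK. Qed.

Lemma edge_neq0 w k : (0 < k < n.+1)%N -> edge w k != 0.
Proof.
move=> hk; rewrite /edge subr_eq0 eqr_nat (inj_eq val_inj) (inj_eq perm_inj).
by rewrite -(inj_eq val_inj) /= !inordK; lia.
Qed.

Lemma sum_localize w a :
  \sum_(S : psub n | a \in val S) localize w S = a%:R - (w ord_max)%:R.
Proof.
rewrite (partition_big (fun S : psub n => inord #|val S| : 'I_n.+1) xpredT) //=.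
have inner (k : 'I_n.+1) :
  \sum_(S : psub n | (a \in val S) && (inord #|val S| == k)) localize w S =
  if (w^-1%g a < k)%N then edge w k else 0.
  have eq_card S : ((inord #|val S| : 'I_n.+1) == k) = (#|val S| == k :> nat).
    by rewrite -(inj_eq val_inj) /= inordK // psub_ltn.
  have [k0|k0] := posnP k.
    rewrite k0 ltn0 big1 // => S /andP[_]; rewrite eq_card k0.
    by have := psub_gt0 S; lia.
  have hk : (0 < k < n.+1)%N by rewrite k0 ltn_ord.
  case: ifP => hak.
    rewrite (bigD1 (prefix_psub w hk)) /=; last first.
      by rewrite in_prefix hak -(inj_eq val_inj) /= card_prefix ?inordK // ltnW.
    rewrite /localize /= card_prefix ?eqxx ?(ltnW (ltn_ord k)) //.
    rewrite big1 ?addr0 // => S /andP[/andP[_]]; rewrite eq_card => /eqP ->.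
    by rewrite -(inj_eq val_inj) /= eq_sym => /negbTE ->.
  rewrite big1 // => S /andP[aS]; rewrite eq_card /localize => /eqP ->.
  by case: eqP => // eqS; rewrite -eqS in_prefix hak in aS.
under eq_bigr => k _ do rewrite inner.
rewrite -(big_mkord xpredT (fun k => if (w^-1%g a < k)%N then edge w k else 0)).
have lt_a := ltn_ord (w^-1%g a).
rewrite (@big_cat_nat _ _ _ (w^-1%g a).+1) //= big_nat big1 ?add0r; last first.
  by move=> k hk; rewrite ltnNge -ltnS; case/andP: hk => _ ->.
rewrite big_add1 /= (eq_big_nat _ _ (F2 := fun k =>
  - ((w (inord k.+1))%:R - (w (inord k))%:R))); last first.
  by move=> k /andP[hk _]; rewrite ltnS hk /edge opprB.
rewrite sumrN telescope_sumr; last by rewrite -ltnS.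
rewrite opprB inord_val permKV.
by congr (_ - (w _)%:R); apply: val_inj; rewrite /= inordK.
Qed.

Lemma local_eval_lin w a b : local_eval w (lin_rel a b) = a%:R - b%:R.
Proof.
have eval_sum x : local_eval w (\sum_(S : psub n | x \in val S) xvar S)
    = x%:R - (w ord_max)%:R.
  rewrite -sum_localize /local_eval raddf_sum /=; apply: eq_bigr => S _.
  exact: local_eval_x.
by rewrite /local_eval /lin_rel mevalB -!/(local_eval w _) !eval_sum; ring.
Qed.

Lemma local_deg_is_linear : linear_for *%R local_deg.
Proof.
move=> c p q; rewrite /local_deg mulr_sumr -big_split /=.
apply: eq_bigr => w _; rewrite /local_eval mevalD mevalZ mulrDl.
by rewrite -mulrA.
Qed.
HB.instance Definition _ :=
  GRing.isLinear.Build rat chow_poly rat *%R local_deg local_deg_is_linear.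

Lemma local_deg_lin p a b :
  local_deg (p * lin_rel a b) = (a%:R - b%:R) * local_deg p.
Proof.
rewrite /local_deg mulr_sumr; apply: eq_bigr => w _.
by rewrite {1}/local_eval mevalM -!/(local_eval w _) local_eval_lin mulrCA -mulrA mulrC.
Qed.

Lemma prefix_nested w S T : Defs.prefix w #|val S| = val S ->
  Defs.prefix w #|val T| = val T -> nested S T.
Proof.
move=> eS eT; rewrite /nested -eS -eT.
by case: (leqP #|val S| #|val T|) => [|/ltnW] /(prefix_mono w) ->; rewrite ?orbT.
Qed.

Lemma local_deg_quad p S T : incomparable S T ->
  local_deg (p * (xvar S * xvar T)) = 0.
Proof.
move=> /incomparableP nST; rewrite /local_deg big1 // => w _.
rewrite {1}/local_eval !mevalM -!/(local_eval w _) !local_eval_x /localize.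
case: eqP => eS; last by rewrite mul0r mulr0 mul0r.
case: eqP => eT; last by rewrite !mulr0 mul0r.
by rewrite (prefix_nested eS eT) in nST.
Qed.

Definition psub_card S : 'I_n.+1 := Ordinal (psub_ltn S).

Lemma psub_card_inj G : chain_set G -> {in G &, injective psub_card}.
Proof.
move=> cG S T hS hT /(congr1 (@nat_of_ord _)) /= eqST.
exact: (chain_card_inj cG).
Qed.

Lemma psub_card_neq0 G : psub_card @: G \subset [set~ ord0].
Proof.
by apply/subsetP => _ /imsetP[S _ ->]; rewrite !inE -lt0n psub_gt0.
Qed.

Lemma chain_card_le G : chain_set G -> (#|G| <= n)%N.
Proof.
move=> cG; have := subset_leq_card (psub_card_neq0 G).
by rewrite (card_in_imset (psub_card_inj cG)) cardsC1 card_ord.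
Qed.

Lemma complete_chain_card G : chain_set G -> #|G| = n ->
  forall k, (0 < k < n.+1)%N -> exists2 S, S \in G & #|val S| = k.
Proof.
move=> cG cardG k hk.
have : psub_card @: G == [set~ ord0].
  rewrite eqEcard psub_card_neq0 (card_in_imset (psub_card_inj cG)).
  by rewrite cardG cardsC1 card_ord leqnn.
move=> /eqP /setP /(_ (inord k)); rewrite !inE -(inj_eq val_inj) /= inordK; last by lia.
have -> : k != 0%N by lia.
case/imsetP => S hS /(congr1 (@nat_of_ord _)) /=; rewrite inordK; last by lia.
by exists S.
Qed.

Lemma local_deg_complete G : chain_set G -> #|G| = n ->
  local_deg (\prod_(S in G) xvar S) = 1.
Proof.
move=> cG cardG; have [w hw] := chain_perm cG.
have Gprefix k (hk : (0 < k < n.+1)%N) : prefix_psub w hk \in G.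
  have [S hS eS] := complete_chain_card cG cardG hk.
  suff -> : prefix_psub w hk = S by [].
  by apply: val_inj; rewrite /= -(hw S hS) eS.
have eval_prod w' : local_eval w' (\prod_(S in G) xvar S)
    = \prod_(S in G) localize w' S.
  rewrite /local_eval rmorph_prod /=; apply: eq_bigr => S _.
  by rewrite -/(local_eval w' _) local_eval_x.
rewrite /local_deg (bigD1 w) //= [X in _ + X]big1 ?addr0 => [|w' nw].
  rewrite eval_prod; set den := \prod_(1 <= k < n.+1) _.
  suff -> : \prod_(S in G) localize w S = den.
    rewrite divff // prodf_seq_neq0; apply/allP => k.
    by rewrite mem_index_iota => /edge_neq0 ->.
  rewrite /den big_nat_cond.
  rewrite (eq_bigr (fun S : psub n => edge w #|val S|)); last first.
    by move=> S hS; rewrite /localize hw // eqxx.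
  rewrite -[RHS]big_filter -(big_image _ _ (fun S : psub n => #|val S|) _ (fun k => edge w k)) /=.
  apply: perm_big; apply: uniq_perm.
  - by rewrite map_inj_in_uniq ?enum_uniq // => S T; rewrite !mem_enum; apply: chain_card_inj.
  - by rewrite filter_uniq // iota_uniq.
  - move=> k; rewrite mem_filter mem_index_iota andbT; apply/imageP/idP => [[S _ ->]|].
      by rewrite psub_gt0 psub_ltn.
    by move=> /andP[hk _]; have [S hS <-] := complete_chain_card cG cardG hk; exists S.
rewrite eval_prod.
suff /existsP[S /andP[hS nS]] : [exists S, (S \in G) && (Defs.prefix w' #|val S| != val S)].
  by rewrite (bigD1 S) //= /localize (negbTE nS) !mul0r.
apply: contraR nw; rewrite negb_exists => /forallP h; apply/eqP.
apply: prefix_perm_inj => k hk.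
have := h (prefix_psub w hk); rewrite Gprefix /= negbK card_prefix; last by lia.
by move/eqP.
Qed.

Lemma chain_unseparated G : chain_set G -> (#|G| < n)%N ->
  exists a b : 'I_n.+1, a != b /\ {in G, forall S, (a \in val S) = (b \in val S)}.
Proof.
move=> cG ltG.
have level_lt x : (#|[set S in G | x \in val S]| < n)%N.
  apply: leq_ltn_trans ltG; apply: subset_leq_card.
  by apply/subsetP => S; rewrite inE => /andP[].
pose level x : 'I_n := Ordinal (level_lt x).
have : ~~ injectiveb level.
  by apply/negP => /injectiveP /leq_card; rewrite !card_ord ltnn.
case/injectivePn => a [b nab /(congr1 (@nat_of_ord _)) /= eq_ab].
exists a, b; split=> // S hS.
have sub x y : [set S in G | x \in val S] \subset [set S in G | y \in val S] \/
    [set S in G | y \in val S] \subset [set S in G | x \in val S].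
  have [|/subsetPn[T]] := boolP (_ \subset _); first by left.
  rewrite !inE => /andP[hT xT]; rewrite hT /= => yT; right.
  apply/subsetP => U; rewrite !inE => /andP[hU yU]; rewrite hU /=.
  have /orP[/subsetP->//|/subsetP sUT] := (chain_setP _ cG) _ _ hT hU.
  by rewrite sUT in yT.
suff /setP/(_ S) : [set S in G | a \in val S] = [set S in G | b \in val S].
  by rewrite !inE hS.
by apply/eqP; case: (sub a b) => h; last rewrite eq_sym; rewrite eqEcard h eq_ab leqnn.
Qed.

End Localization.

Section LocalDegree.
Variable n : nat.
Implicit Types (S T U : psub n) (G : {set psub n}) (w : 'S_n.+1) (s : seq (psub n)).

Local Notation chow_poly := {mpoly rat[#|{: psub n}|]}.

Lemma local_deg_chainU (G : {set psub n}) S :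
    S \notin G -> (forall H : {set psub n}, chain_set H -> (#|G| < #|H|)%N ->
    local_deg (\prod_(T in H) xvar T) = (#|H| == n)%:R) ->
  chain_set G ->
  local_deg (\prod_(T in G) xvar T * xvar S)
    = ([forall T in G, nested S T] && (#|G|.+1 == n))%:R.
Proof.
move=> hS IH cG; case: (boolP [forall T in G, nested S T]) => [nest|].
  rewrite mulrC -prod_setU1 // IH ?cardsU1 ?hS ?add1n //.
  by rewrite chain_setU1 cG.
case/forall_inPn => U hU /incomparableP nSU.
rewrite (bigD1 U) //= [xvar U * _]mulrC -mulrA [xvar U * _]mulrC.
exact: local_deg_quad.
Qed.

(* If a and b are not separated by G, then (a - b) times the left-hand side is a sum
   over longer chains, in which the transposition of a and b cancels all terms. *)
Lemma local_deg_chain G : chain_set G ->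
  local_deg (\prod_(S in G) xvar S) = (#|G| == n)%:R.
Proof.
have [k] := ubnP (n - #|G|); elim: k G => // k IHk G ltk cG.
have le_Gn := chain_card_le cG.
have [eqG|neG] := eqVneq #|G| n; first by rewrite local_deg_complete.
have ltG : (#|G| < n)%N by rewrite ltn_neqAle neG.
have IH (H : {set psub n}) : chain_set H -> (#|G| < #|H|)%N ->
    local_deg (\prod_(S in H) xvar S) = (#|H| == n)%:R.
  by move=> cH lt_GH; apply: IHk => //; have := chain_card_le cH; lia.
have [a [b [nab eq_ab]]] := chain_unseparated cG ltG.
have nz : (a%:R - b%:R : rat) != 0 by rewrite subr_eq0 eqr_nat (inj_eq val_inj).
apply: (mulfI nz); rewrite mulr0 -local_deg_lin lin_relE mulrBr !mulr_sumr raddfB.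
apply/eqP; rewrite subr_eq0; apply/eqP.
rewrite [LHS](raddf_sum (@local_deg n)) [RHS](raddf_sum (@local_deg n)).
pose swap (S : {set 'I_n.+1}) := [set tperm a b x | x in S].
have swap_psub S : (swap (val S) != set0) && (swap (val S) != setT).
  rewrite -card_gt0 card_imset ?psub_gt0 //=; last exact: perm_inj.
  apply/eqP => eqT; have := psub_ltn S.
  by rewrite -(card_imset (mem (val S)) (@perm_inj _ (tperm a b))) -/(swap _) eqT cardsT card_ord ltnn.
pose swp S : psub n := Sub (swap (val S)) (swap_psub S).
have mem_swp x S : (x \in val (swp S)) = (tperm a b x \in val S).
  by rewrite /= -{1}[x](tpermK a b) (mem_imset _ _ (@perm_inj _ (tperm a b))).
have swpK : involutive swp.
  by move=> S; apply: val_inj; apply/setP => x; rewrite !mem_swp tpermK.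
have sub_swp S T : (val (swp S) \subset val (swp T)) = (val S \subset val T).
  apply/subsetP/subsetP => sub x; last by rewrite !mem_swp; apply: sub.
  by have := sub (tperm a b x); rewrite !mem_swp tpermK.
have swp_nested S T : T \in G -> nested (swp S) T = nested S T.
  move=> hT; have swpT : swp T = T.
    apply: val_inj; apply/setP => x; rewrite mem_swp.
    by case: tpermP => // ->; rewrite eq_ab.
  by rewrite -{1}swpT /nested !sub_swp.
have term x y S : {in G, forall S, (x \in val S) = (y \in val S)} ->
    (x \in val S) && (y \notin val S) ->
    local_deg (\prod_(T in G) xvar T * xvar S)
    = ([forall T in G, nested S T] && (#|G|.+1 == n))%:R.
  move=> eq_xy /andP[xS yS]; apply: local_deg_chainU => //.
  by apply: contra yS => hS; rewrite -eq_xy.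
rewrite [LHS](eq_bigr _ (fun S => term a b S eq_ab)).
rewrite [RHS](eq_bigr _ (fun S => term b a S (fun T hT => esym (eq_ab T hT)))).
rewrite [RHS](reindex_inj (inv_inj swpK)) /=.
apply: eq_big => S; first by rewrite !mem_swp tpermL tpermR.
move=> _; congr (_ && _)%:R; apply: eq_forallb_in => T hT.
by rewrite swp_nested.
Qed.

Lemma local_deg_small s : (size s < n)%N ->
  local_deg (\prod_(S <- s) xvar S) = 0.
Proof.
have [k] := ubnP (size s); elim: k s => // k IHk s ltk lts.
apply: (@straightening _ (fun p => local_deg p = 0) (size s)) => //.
- by move=> p q; rewrite raddfD /= => -> ->; rewrite addr0.
- by move=> p; rewrite raddfN /= => ->; rewrite oppr0.
- by move=> p S T; apply: local_deg_quad.
- move=> u a b eq_u; rewrite local_deg_lin IHk ?mulr0 //; lia.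
- by move=> G cG eqG; rewrite local_deg_chain // eqG ltn_eqF.
Qed.

Lemma mpolyX_seq (m : 'X_{1..#|{: psub n}|}) :
  exists2 s, size s = mdeg m & 'X_[m] = \prod_(S <- s) xvar S :> chow_poly.
Proof.
exists (flatten [seq nseq (m (enum_rank T)) T | T <- enum {: psub n}]).
  rewrite size_flatten /shape -map_comp (eq_map (fun S => size_nseq (m (enum_rank S)) S)).
  rewrite sumnE big_map big_enum /= mdegE (reindex enum_rank) //=.
  by apply: onW_bij; apply: enum_rank_bij.
rewrite big_flatten big_map big_enum /= mpolyXE_id (reindex enum_rank) /=; last first.
  by apply: onW_bij; apply: enum_rank_bij.
by apply: eq_bigr => S _; rewrite big_nseq_cond iter_mulr_1.
Qed.

Definition poly_deg (p : chow_poly) : rat := local_deg (pihomog [measure of mdeg] n p).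

Lemma poly_deg_is_linear : linear_for *%R poly_deg.
Proof. by move=> c p q; rewrite /poly_deg linearP /= linearP. Qed.
HB.instance Definition _ :=
  GRing.isLinear.Build rat chow_poly rat *%R poly_deg poly_deg_is_linear.

Lemma poly_deg_homog p : p \is n.-homog -> poly_deg p = local_deg p.
Proof. by move=> hp; rewrite /poly_deg pihomog_dE. Qed.

Lemma poly_deg_homog_neq k p : p \is k.-homog -> k != n -> poly_deg p = 0.
Proof. by move=> hp nk; rewrite /poly_deg (pihomog_ne0 nk) ?raddf0. Qed.

Lemma xvar_homog S : xvar S \is 1.-homog.
Proof. by rewrite /xvar dhomogX /= mdeg1. Qed.

Lemma prod_xvar_homog (I : Type) (l : seq I) (P : pred I) (F : I -> psub n) :
  \prod_(i <- l | P i) xvar (F i) \is (count P l).-homog.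
Proof.
elim: l => [|i l IHl]; first by rewrite big_nil dhomog1.
rewrite big_cons /=; case: (P i) => //=.
by rewrite dhomogM // xvar_homog.
Qed.

Lemma lin_rel_homog (a b : 'I_n.+1) : lin_rel a b \is 1.-homog.
Proof.
by rewrite /lin_rel rpredB // rpred_sum // => S _; apply: xvar_homog.
Qed.

Lemma poly_deg_ideal p : chow_ideal p -> poly_deg p = 0.
Proof.
suff main : chow_ideal p -> forall q, poly_deg (q * p) = 0.
  by move/main/(_ 1); rewrite mul1r.
elim=> [a b|S T nST||p1 p2 _ h1 _ h2|p1 p2 _ h] q; last first.
- by rewrite mulrA.
- by rewrite mulrDr raddfD /= h1 h2 addr0.
- by rewrite mulr0 raddf0.
- rewrite [q]mpolyE; rewrite mulr_suml raddf_sum big1 //= => m _.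
  rewrite -scalerAl linearZ /=.
  have hom : 'X_[m] * (xvar S * xvar T) \is (mdeg m + (1 + 1)).-homog.
    by rewrite !dhomogM ?xvar_homog // dhomogX.
  have [eqn|nen] := eqVneq (mdeg m + (1 + 1))%N n.
    by move: hom; rewrite eqn => hom; rewrite poly_deg_homog // local_deg_quad // mulr0.
  by rewrite (poly_deg_homog_neq hom nen) mulr0.
- rewrite [q]mpolyE; rewrite mulr_suml raddf_sum big1 //= => m _.
  rewrite -scalerAl linearZ /= -/(lin_rel a b).
  have hom : 'X_[m] * lin_rel a b \is (mdeg m + 1).-homog.
    by rewrite dhomogM ?lin_rel_homog // dhomogX.
  have [eqn|nen] := eqVneq (mdeg m + 1)%N n.
    move: hom; rewrite eqn => hom; rewrite poly_deg_homog // local_deg_lin.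
    have [s size_s ->] := mpolyX_seq m.
    by rewrite local_deg_small ?mulr0 // size_s; lia.
  by rewrite (poly_deg_homog_neq hom nen) mulr0.
Qed.

End LocalDegree.

Section ChowDegree.
Variable n : nat.
Implicit Types (S T U : psub n) (G : {set psub n}) (w : 'S_n.+1) (s : seq (psub n)) (x y : chow n).

Local Notation chow_poly := {mpoly rat[#|{: psub n}|]}.

Lemma chow_class_zmod : zmod_morphism (@chow_class n).
Proof. exact: (raddfB (\pi_({ideal_quot (@chow_idealb n)}))%qT). Qed.

Lemma chow_class_monoid : monoid_morphism (@chow_class n).
Proof.
split; first exact: (rmorph1 (\pi_({ideal_quot (@chow_idealb n)}))%qT).
exact: (rmorphM (\pi_({ideal_quot (@chow_idealb n)}))%qT).
Qed.

HB.instance Definition _ :=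
  GRing.isZmodMorphism.Build chow_poly (chow n) (@chow_class n) chow_class_zmod.
HB.instance Definition _ :=
  GRing.isMonoidMorphism.Build chow_poly (chow n) (@chow_class n) chow_class_monoid.

Lemma chow_classP (p q : chow_poly) :
  chow_class p = chow_class q <-> chow_ideal (p - q).
Proof.
split=> [/eqP h|/chow_idealP h].
  by apply/chow_idealP; rewrite Quotient.idealrBE.
by apply/eqP; rewrite Quotient.idealrBE in h.
Qed.

Lemma chow_class_eq0 (p : chow_poly) : chow_ideal p -> chow_class p = 0.
Proof. by move=> hp; rewrite -(raddf0 (@chow_class n)); apply/chow_classP; rewrite subr0. Qed.

Lemma chow_reprK (x : chow n) : exists p, x = chow_class p.
Proof. by exists (generic_quotient.repr x); rewrite /chow_class reprK. Qed.

Definition chow_deg (x : chow n) : rat := poly_deg (generic_quotient.repr x : chow_poly).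

Lemma chow_degE (p : chow_poly) : chow_deg (chow_class p) = poly_deg p.
Proof.
apply/eqP; rewrite -subr_eq0 /chow_deg -raddfB; apply/eqP/poly_deg_ideal/chow_classP.
by rewrite /chow_class reprK.
Qed.

Lemma chow_deg_zmod : zmod_morphism chow_deg.
Proof.
move=> x y; have [p ->] := chow_reprK x; have [q ->] := chow_reprK y.
by rewrite -raddfB !chow_degE raddfB.
Qed.
HB.instance Definition _ :=
  GRing.isZmodMorphism.Build (chow n) rat chow_deg chow_deg_zmod.

Lemma chow_deg_scale c x : chow_deg (chow_scale c x) = c * chow_deg x.
Proof.
have [p ->] := chow_reprK x.
by rewrite /chow_scale -rmorphM !chow_degE mul_mpolyC linearZ.
Qed.

Lemma chow_scaleDl c c' (x : chow n) : chow_scale (c + c') x = chow_scale c x + chow_scale c' x.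
Proof. by rewrite /chow_scale mpolyCD rmorphD mulrDl. Qed.

Lemma chow_scaleA c c' (x : chow n) : chow_scale c (chow_scale c' x) = chow_scale (c * c') x.
Proof. by rewrite /chow_scale mpolyCM rmorphM mulrA. Qed.

Lemma chow_scale1 (x : chow n) : chow_scale 1 x = x.
Proof. by rewrite /chow_scale mpolyC1 rmorph1 mul1r. Qed.

Lemma chow_scaleN1 (x : chow n) : chow_scale (-1) x = - x.
Proof. by rewrite /chow_scale mpolyCN rmorphN mpolyC1 rmorph1 mulN1r. Qed.

Lemma chow_scale0 (x : chow n) : chow_scale 0 x = 0.
Proof. by rewrite /chow_scale mpolyC0 rmorph0 mul0r. Qed.

Lemma x_mul_incomparable S T : ~~ nested S T -> x_ S * x_ T = 0.
Proof.
move=> nST; rewrite /x_ -rmorphM; apply: chow_class_eq0.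
by apply: chow_quad; apply/incomparableP.
Qed.

Lemma x_lin a b :
  \sum_(S : psub n | a \in val S) x_ S = \sum_(S : psub n | b \in val S) x_ S.
Proof.
rewrite /x_ -!rmorph_sum; apply/chow_classP; exact: chow_lin.
Qed.

Definition alpha : chow n := \sum_(S : psub n | ord0 \in val S) x_ S.

Lemma x_alpha_eq0 S m : (n < #|val S| + m)%N -> x_ S * alpha ^+ m = 0.
Proof.
elim: m S => [|m IHm] S; first by rewrite addn0 ltnNge -ltnS psub_ltn.
move=> lt_nm; have /properP[_ [b _ bS]] : val S \proper setT.
  by rewrite properT; case: (S) => ? /= /andP[].
rewrite exprS mulrA [X in _ * X * _](x_lin ord0 b) mulr_sumr mulr_suml big1 // => T bT.
have [/orP[sST|sTS]|/x_mul_incomparable ->] := boolP (nested S T).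
- rewrite -mulrA IHm ?mulr0 //.
  have : val S \proper val T by apply/properP; split=> //; exists b.
  by move=> /proper_card ltST; apply: leq_trans lt_nm _; rewrite addnS -addSn leq_add2r.
- by rewrite (subsetP sTS) in bS.
- by rewrite mul0r.
Qed.

Definition prefixes w (k : nat) : {set psub n} :=
  [set S : psub n | (Defs.prefix w #|val S| == val S) && (#|val S| <= k)%N].

(* All complete chain monomials are equal: each is alpha^n. *)
Lemma prod_prefixes w k : (k <= n)%N ->
  \prod_(S in prefixes w k) x_ S * alpha ^+ (n - k) = alpha ^+ n.
Proof.
elim: k => [|k IHk] lekn.
  rewrite subn0 big1 ?mul1r // => S; rewrite inE.
  by case/andP=> _; have := psub_gt0 S; lia.
have hk : (0 < k.+1 < n.+1)%N by rewrite ltnS.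
pose P := prefix_psub w hk.
have cardP : #|val P| = k.+1 by rewrite card_prefix // ltnW.
have -> : prefixes w k.+1 = P |: prefixes w k.
  apply/setP => S; rewrite !inE [(_ <= k.+1)%N]leq_eqVlt ltnS andb_orr; congr (_ || _).
  apply/andP/eqP => [[/eqP eS /eqP cS]|->]; last by rewrite cardP eqxx.
  by apply: val_inj; rewrite /= -eS cS.
rewrite big_setU1 /=; last by rewrite inE cardP ltnn andbF.
rewrite -(IHk (ltnW lekn)) -(subnSK lekn) exprS.
pose a := w (inord k).
have wVa : w^-1%g a = k :> nat by rewrite /a permK inordK // ltnW.
rewrite {2}/alpha (x_lin ord0 a) mulr_suml mulr_sumr [RHS](bigD1 P) /=; last first.
  by change (a \in Defs.prefix w k.+1); rewrite in_prefix wVa.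
rewrite [X in _ = _ + X]big1 ?addr0; last first.
  move=> S /andP[aS nSP]; have [lt_kS|le_Sk] := ltnP k.+1 #|val S|.
    by rewrite x_alpha_eq0 ?mulr0 //; lia.
  suff [T hT nTS] : exists2 T, T \in prefixes w k & ~~ nested T S.
    by rewrite (bigD1 T) //= mulrACA x_mul_incomparable // mul0r.
  have cardS : (0 < #|val S|)%N := psub_gt0 S.
  have nsub : ~~ (Defs.prefix w k \subset val S).
    apply: contra nSP => sub; have subP : val P \subset val S.
      apply/subsetP => x; change (x \in Defs.prefix w k.+1 -> x \in val S).
      rewrite in_prefix ltnS leq_eqVlt => /orP[/eqP xk|xk].
        suff -> : x = a by [].
        by apply: (@perm_inj _ w^-1%g); apply: val_inj; rewrite /= xk wVa.
      by apply: (subsetP sub); rewrite in_prefix.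
    by rewrite eq_sym -(inj_eq val_inj) eqEcard subP cardP.
  have k0 : (0 < k < n.+1)%N.
    rewrite ltnS (ltnW lekn) andbT lt0n; apply: contra nsub => /eqP ->.
    by rewrite prefix0 sub0set.
  exists (prefix_psub w k0); first by rewrite inE /= card_prefix ?eqxx ?leqnn // ltnW // ltnW.
  rewrite /nested (negbTE nsub) /=; apply/subsetPn; exists a => //.
  by rewrite in_prefix wVa ltnn.
by rewrite mulrA [x_ P * _]mulrC -mulrA.
Qed.

Lemma x_complete G : chain_set G -> #|G| = n -> \prod_(S in G) x_ S = alpha ^+ n.
Proof.
move=> cG cardG; have [w hw] := chain_perm cG.
rewrite -(prod_prefixes w (leqnn n)) subnn mulr1; apply: eq_bigl => S.
rewrite inE; apply/idP/andP => [hS|[/eqP eS le_Sn]].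
  by rewrite hw // eqxx -ltnS psub_ltn.
have [|T hT cT] := complete_chain_card cG cardG (k := #|val S|).
  by rewrite psub_gt0 psub_ltn.
suff -> : S = T by [].
by apply: val_inj; rewrite /= -eS -cT hw.
Qed.

Lemma prod_set_homog G : \prod_(S in G) xvar S \is #|G|.-homog.
Proof.
by rewrite -big_enum; have := prod_xvar_homog (enum G) predT id; rewrite count_predT -cardE.
Qed.

Lemma chow_graded_top x : chow_graded n x ->
  x = chow_scale (chow_deg x) (alpha ^+ n).
Proof.
case=> p hp ->; rewrite chow_degE.
pose P (q : chow_poly) := chow_class q = chow_scale (poly_deg q) (alpha ^+ n).
have P0 : P 0 by rewrite /P !raddf0 chow_scale0.
have PD q q' : P q -> P q' -> P (q + q').
  by rewrite /P !raddfD /= chow_scaleDl => -> ->.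
have PZ c q : P q -> P (c *: q).
  move=> hq; rewrite /P linearZ /= -mul_mpolyC rmorphM /= hq.
  by rewrite -chow_scaleA.
have PN q : P q -> P (- q) by move=> hq; rewrite -scaleN1r; apply: PZ.
have Pideal q : chow_ideal q -> P q.
  by move=> hq; rewrite /P poly_deg_ideal // chow_class_eq0 // chow_scale0.
have Pseq s : size s = n -> P (\prod_(S <- s) xvar S).
  apply: (@straightening _ P n) => //.
  - move=> q S T nST; apply: Pideal; apply: chow_mul; exact: chow_quad.
  - move=> u a b _; apply: Pideal; apply: chow_mul; exact: chow_lin.
  - move=> G cG cardG; rewrite /P rmorph_prod /= x_complete //.
    rewrite poly_deg_homog ?local_deg_complete ?chow_scale1 //.
    by have := prod_set_homog G; rewrite cardG.
rewrite -/(P p) [p]mpolyE; rewrite big_seq; elim/big_ind: _ => // m hm.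
apply: PZ; have [s size_s ->] := mpolyX_seq m; apply: Pseq.
by rewrite size_s; move/dhomogP: hp => /(_ m hm).
Qed.

Lemma chow_gradedZD k c x y : chow_graded k x -> chow_graded k y ->
  chow_graded k (chow_scale c x + y).
Proof.
case=> p hp -> [q hq ->]; exists (c *: p + q); first by rewrite rpredD ?rpredZ.
by rewrite rmorphD /= -mul_mpolyC rmorphM.
Qed.

Lemma chow_gradedM k l x y : chow_graded k x -> chow_graded l y ->
  chow_graded (k + l) (x * y).
Proof.
case=> p hp -> [q hq ->]; exists (p * q); first exact: dhomogM.
by rewrite rmorphM.
Qed.

Lemma chow_graded_x S : chow_graded 1 (x_ S).
Proof. by exists (xvar S) => //; apply: xvar_homog. Qed.

Lemma chow_graded1 : chow_graded 0 (1 : chow n).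
Proof. by exists 1; [apply: dhomog1 | rewrite rmorph1]. Qed.

Lemma chow_graded0 k : chow_graded k (0 : chow n).
Proof. by exists 0; [apply: dhomog0 | rewrite raddf0]. Qed.

Lemma chow_graded_sum (I : Type) (l : seq I) (P : pred I) (c : I -> rat) (F : I -> chow n) k :
  (forall i, P i -> chow_graded k (F i)) ->
  chow_graded k (\sum_(i <- l | P i) chow_scale (c i) (F i)).
Proof.
move=> hF; elim/big_rec: _ => [|i y Pi hy]; first exact: chow_graded0.
by apply: chow_gradedZD => //; apply: hF.
Qed.

Lemma chow_graded_prod (I : Type) (l : seq I) (F : I -> chow n) (k : I -> nat) :
  (forall i, chow_graded (k i) (F i)) ->
  chow_graded (\sum_(i <- l) k i) (\prod_(i <- l) F i).
Proof.
move=> hF; elim: l => [|i l IHl]; first by rewrite !big_nil; apply: chow_graded1.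
by rewrite !big_cons; apply: chow_gradedM.
Qed.

Lemma chow_gradedX k m x : chow_graded k x -> chow_graded (m * k) (x ^+ m).
Proof.
move=> hx; elim: m => [|m IHm]; first by rewrite expr0; apply: chow_graded1.
by rewrite exprS mulSn; apply: chow_gradedM.
Qed.

Lemma chow_graded_monomial s : chow_graded (size s) (chow_monomial s).
Proof.
by rewrite -sum1_size; apply: chow_graded_prod => S; apply: chow_graded_x.
Qed.

Lemma is_chain_set s : is_chain s ->
  [/\ uniq s, chain_set [set S in s] & #|[set S in s]| = size s].
Proof.
move=> cs; have tr : transitive (fun S T : psub n => val S \proper val T).
  by move=> S T U; apply: proper_trans.
have us : uniq s by apply: sorted_uniq cs => // S; apply: properxx.
split=> //; last by rewrite cardsE (card_uniqP us).
move: cs; rewrite /is_chain sorted_pairwise //.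
case: s us => [_ _|S0 s us]; first by apply/chain_setP => S T; rewrite inE.
move/(pairwiseP S0) => hs; apply/chain_setP => S T; rewrite !inE -!in_cons => hS hT.
have hi U : U \in S0 :: s -> index U (S0 :: s) \in gtn (size (S0 :: s)).
  by rewrite -index_mem.
rewrite /nested -(nth_index S0 hS) -(nth_index S0 hT).
case: (ltngtP (index S (S0 :: s)) (index T (S0 :: s))) => [lt|lt|->].
- by apply/orP; left; apply: proper_sub; apply: hs lt; apply: hi.
- by apply/orP; right; apply: proper_sub; apply: hs lt; apply: hi.
- by rewrite subxx.
Qed.

Lemma is_chain_tuple r (f : 'I_r -> psub n) :
  (forall i j : 'I_r, (i < j)%N -> val (f i) \proper val (f j)) ->
  is_chain [tuple f i | i < r].
Proof.
move=> hf; rewrite /is_chain /= sorted_map.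
apply: (sub_sorted (e := relpre val ltn)) => [i j|]; first exact: hf.
by rewrite -sorted_map val_enum_ord iota_ltn_sorted.
Qed.

Lemma chow_deg_chain G : chain_set G -> #|G| = n ->
  chow_deg (\prod_(S in G) x_ S) = 1.
Proof.
move=> cG cardG.
rewrite /x_ -rmorph_prod /= chow_degE poly_deg_homog ?local_deg_complete //.
by have := prod_set_homog G; rewrite cardG.
Qed.

Lemma chow_monomial_chain s : is_chain s ->
  chow_monomial s = \prod_(S in [set S in s]) x_ S.
Proof.
case/is_chain_set => us _ _; rewrite /chow_monomial.
by rewrite (big_uniq _ us) /=; apply: eq_bigl => S; rewrite inE.
Qed.

Lemma chow_monomial_complete (F : n.-tuple (psub n)) : is_chain F ->
  chow_monomial F = alpha ^+ n.
Proof.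
move=> cF; rewrite chow_monomial_chain //; have [_ cG cardG] := is_chain_set cF.
by rewrite x_complete // cardG size_tuple.
Qed.

Lemma complete_chain_ex : exists F : n.-tuple (psub n), is_chain F.
Proof.
have hk (i : 'I_n) : (0 < i.+1 < n.+1)%N by exact: (ltn_ord i).
exists [tuple prefix_psub 1%g (hk i) | i < n]; apply: is_chain_tuple => i j lt_ij.
rewrite properEcard /= !card_prefix ?ltnS ?lt_ij ?andbT; first 1 last.
- exact: ltnW (ltn_ord j).
- exact: ltnW (ltn_ord i).
by apply: prefix_mono; apply: ltnW.
Qed.

Lemma alpha_top : chow_graded n (alpha ^+ n) /\ chow_deg (alpha ^+ n) = 1.
Proof.
have [F cF] := complete_chain_ex; rewrite -(chow_monomial_complete cF); split.
  by have := chow_graded_monomial F; rewrite size_tuple.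
rewrite chow_monomial_chain //; have [_ cG cardG] := is_chain_set cF.
by rewrite chow_deg_chain // cardG size_tuple.
Qed.

Lemma chow_deg_is_degree_map : is_degree_map chow_deg.
Proof.
have [top_alpha deg_alpha] := alpha_top; split.
- by move=> c x y _ _; rewrite raddfD /= chow_deg_scale.
- by move=> x y /chow_graded_top ex /chow_graded_top ey eq_xy; rewrite ex ey eq_xy.
- move=> q; exists (chow_scale q (alpha ^+ n)); last by rewrite chow_deg_scale deg_alpha mulr1.
  rewrite -[chow_scale _ _]addr0; apply: chow_gradedZD => //; exact: chow_graded0.
- by move=> F cF; rewrite chow_monomial_complete.
Qed.

Lemma degree_map_top x : chow_graded n x -> degree_map x = chow_deg x.
Proof.
move=> hx; have [top_alpha deg_alpha] := alpha_top.
have [dlin _ _ dchain] : is_degree_map (@degree_map n).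
  exact: (epsilon_spec _ _ (ex_intro _ _ chow_deg_is_degree_map)).
have d0 : degree_map (0 : chow n) = 0.
  have := dlin 1 0 0 (chow_graded0 n) (chow_graded0 n).
  by rewrite addr0 chow_scale1 mul1r => /eqP; rewrite -subr_eq0 opprD addrA subrr sub0r oppr_eq0 => /eqP.
have [F cF] := complete_chain_ex.
rewrite {1}(chow_graded_top hx) -[chow_scale _ _]addr0 dlin //; last exact: chow_graded0.
by rewrite d0 -(chow_monomial_complete cF) dchain // addr0 mulr1.
Qed.

End ChowDegree.

(** * Bergman classes *)

Section MatroidLemmas.
Variables (E : finType) (k : nat) (M : matroid E k).
Implicit Types (A B F : {set E}) (e x : E).

Lemma rk_submodU1 e A B : A \subset B ->
  (M (e |: B) + M A <= M (e |: A) + M B)%N.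
Proof.
move=> sAB; have := rk_submod M (e |: A) B.
rewrite -setUA (setUidPr sAB); apply: leq_trans; rewrite leq_add2l.
by apply: rk_mono; rewrite subsetI sAB subsetU1.
Qed.

Lemma rk_le_addD A B : A \subset B -> (M B <= M A + #|B :\: A|)%N.
Proof.
move=> sAB; have := rk_submod M A (B :\: A).
rewrite -{1}(setIidPr sAB) setID => h.
by have := rk_le_card M (B :\: A); lia.
Qed.

Lemma rk_le A : (M A <= k)%N.
Proof. by have := rk_mono M (subsetT A); rewrite rk_setT. Qed.

Definition mclosure A := [set x | M (x |: A) == M A].

Lemma sub_closure A : A \subset mclosure A.
Proof. by apply/subsetP => x xA; rewrite inE (setUidPr _) ?sub1set. Qed.

Lemma rk_closure A : M (mclosure A) = M A.
Proof.
suff h (s : seq E) : {subset s <= mclosure A} -> M (A :|: [set x in s]) = M A.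
  rewrite -{1}(setUidPr (sub_closure A)) -[X in A :|: X](set_enum (mclosure A)).
  by apply: h => x; rewrite mem_enum.
elim: s => [_|x s IHs hs].
  by congr (rk M _); apply/setP => x; rewrite !inE orbF.
have {}IHs : M (A :|: [set x in s]) = M A.
  by apply: IHs => y ys; apply: hs; rewrite inE ys orbT.
have := hs x (mem_head _ _); rewrite inE => /eqP Mx.
have := rk_submodU1 x (subsetUl A [set x in s]).
have -> : x |: (A :|: [set x in s]) = A :|: [set y in x :: s].
  by apply/setP => y; rewrite !inE orbCA.
have := rk_mono M (subsetUl A [set y in x :: s]).
lia.
Qed.

Lemma flatP F : reflect (forall e, e \notin F -> (M F < M (e |: F))%N) (flat M F).
Proof.
apply: (iffP forall_inP) => h e; first by move=> he; apply: h; rewrite inE.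
by rewrite inE; apply: h.
Qed.

Lemma flat_rk_lt F B : flat M F -> F \proper B -> (M F < M B)%N.
Proof.
move=> /flatP fF /properP[sFB [e eB eF]].
by apply: leq_trans (fF e eF) _; apply: rk_mono; rewrite subUset sub1set eB.
Qed.

Lemma flat_eq F B : flat M F -> F \subset B -> (M B <= M F)%N -> F = B.
Proof.
move=> fF sFB leBF; apply/eqP; rewrite eqEproper sFB /=.
by apply: contraTN leBF => /(flat_rk_lt fF); rewrite ltnNge.
Qed.

Lemma flat_setT : flat M setT.
Proof. by apply/flatP => e; rewrite inE. Qed.

Lemma flat_closure A : flat M (mclosure A).
Proof.
apply/flatP => e; rewrite inE rk_closure => nMe.
have := rk_mono M (setUS [set e] (sub_closure A)).
by have := rk_mono M (subsetU1 e A); move/eqP: nMe; lia.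
Qed.

Lemma closure_sub A F : flat M F -> A \subset F -> mclosure A \subset F.
Proof.
move=> /flatP fF sAF; apply/subsetP => x; rewrite inE => /eqP Mx.
apply: contraLR (leqnn (M F)) => /fF; rewrite -ltnNge => ltF.
by have := rk_submodU1 x sAF; lia.
Qed.

Lemma closureS A B : A \subset B -> mclosure A \subset mclosure B.
Proof.
move=> sAB; apply: closure_sub; first exact: flat_closure.
exact: subset_trans sAB (sub_closure B).
Qed.

Lemma closure_flat A F : flat M F -> A \subset F -> M A = M F -> mclosure A = F.
Proof.
move=> fF sAF eqM; apply: flat_eq; first exact: flat_closure.
  exact: closure_sub.
by rewrite rk_closure eqM.
Qed.

Lemma loopless_rk_gt0 A : loopless M -> A != set0 -> (0 < M A)%N.
Proof.
move=> lM /set0Pn[x xA]; rewrite -[X in (X <= _)%N](lM x).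
by apply: rk_mono; rewrite sub1set.
Qed.

Lemma loopless_flat0 : loopless M -> flat M set0.
Proof. by move=> lM; apply/flatP => e _; rewrite matroid_rk0 setU0 lM. Qed.

End MatroidLemmas.

Section HiggsLift.
Variables (E : finType) (k : nat) (M : matroid E k).
Hypothesis ltk : (k < #|E|)%N.
Implicit Types A B : {set E}.

Definition higgs_rk A := minn #|A| (M A).+1.

Lemma higgs_le_card A : (higgs_rk A <= #|A|)%N.
Proof. exact: geq_minl. Qed.

Lemma higgs_mono A B : A \subset B -> (higgs_rk A <= higgs_rk B)%N.
Proof.
move=> sAB; have := subset_leq_card sAB; have := rk_mono M sAB.
by rewrite /higgs_rk; lia.
Qed.

Lemma higgs_submod A B :
  (higgs_rk (A :|: B) + higgs_rk (A :&: B) <= higgs_rk A + higgs_rk B)%N.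
Proof.
have cardUI : (#|A :|: B| + #|A :&: B| = #|A| + #|B|)%N := cardsUI A B.
have sub := rk_submod M A B.
have rkU A' B' : (M (A' :|: B') + #|A' :&: B'| <= M B' + #|A'|)%N.
  have := rk_le_addD M (subsetUr A' B').
  rewrite setDUl setDv setU0 => h.
  by have := cardsID B' A'; lia.
have rkAB := rkU A B; have := rkU B A; rewrite setUC setIC => rkBA.
by rewrite /higgs_rk; lia.
Qed.

Lemma higgs_setT : higgs_rk [set: E] = k.+1.
Proof. by rewrite /higgs_rk rk_setT cardsT; lia. Qed.

Definition higgs : matroid E k.+1 :=
  Matroid higgs_le_card higgs_mono higgs_submod higgs_setT.

Lemma higgs_loopless : loopless M -> loopless higgs.
Proof. by move=> lM e; rewrite /= /higgs_rk cards1 lM. Qed.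

End HiggsLift.

Section FlagsOfFlats.
Variables (n k : nat) (M : matroid 'I_n.+1 k).
Hypothesis lM : loopless M.
Implicit Types (S T U : psub n) (G : {set psub n}).

Lemma flat_psub_rk S : flat M (val S) -> (0 < M (val S) < k)%N.
Proof.
have /andP[S0 ST] := valP S; move=> fS; rewrite (loopless_rk_gt0 lM S0) /=.
by have := flat_rk_lt fS; rewrite -properT in ST => /(_ _ ST); rewrite rk_setT.
Qed.

Lemma chain_flat_rk_inj G : chain_set G -> {in G, forall S, flat M (val S)} ->
  {in G &, injective (fun S => M (val S))}.
Proof.
move=> /chain_setP cG fG S T hS hT /= eqM; apply: val_inj.
have /orP[sST|sTS] := cG _ _ hS hT; first by apply: (flat_eq (fG _ hS)); rewrite ?eqM.
by apply/esym/(flat_eq (fG _ hT)); rewrite ?eqM.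
Qed.

Lemma chain_flat_sub G : chain_set G -> {in G, forall S, flat M (val S)} ->
  {in G &, forall S T, (M (val S) <= M (val T))%N -> val S \subset val T}.
Proof.
move=> /chain_setP cG fG S T hS hT leM.
have /orP[//|sTS] := cG _ _ hS hT.
by rewrite (flat_eq (fG _ hT) sTS leM).
Qed.

Definition flat_ranks G : {set 'I_k} := [set i : 'I_k | [exists S in G, M (val S) == i]].

Lemma card_flat_ranks G : chain_set G -> {in G, forall S, flat M (val S)} ->
  #|flat_ranks G| = #|G|.
Proof.
move=> cG fG; have hk S : S \in G -> (M (val S) < k)%N.
  by move=> hS; case/andP: (flat_psub_rk (fG S hS)).
case: (posnP k) => [k0|k_gt0].
  have G0 : G = set0.
    by apply/setP => S; rewrite inE; apply/negP => /hk; lia.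
  rewrite G0 cards0; apply: eq_card0 => i.
  by have := ltn_ord i; lia.
pose f S := insubd (Ordinal k_gt0) (M (val S)) : 'I_k.
have fE S : S \in G -> f S = M (val S) :> nat by move=> hS; rewrite val_insubd hk.
rewrite -(card_in_imset (f := f) (D := mem G)); last first.
  move=> S T hS hT /(congr1 (@nat_of_ord _)); rewrite !fE // => eqM.
  exact: (chain_flat_rk_inj cG fG).
apply: eq_card => i; rewrite inE; apply/exists_inP/imsetP => [[S hS /eqP eS]|[S hS ->]].
  by exists S => //; apply: val_inj; rewrite /= fE.
by exists S => //; rewrite fE.
Qed.

Lemma flat_ranks_gt0 G : {in G, forall S, flat M (val S)} ->
  flat_ranks G \subset [set i : 'I_k | 0 < i]%N.
Proof.
move=> fG; apply/subsetP => i; rewrite !inE => /exists_inP[S hS /eqP <-].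
by case/andP: (flat_psub_rk (fG S hS)).
Qed.

End FlagsOfFlats.

Section FlagRanks.
Variables (n r : nat).
Implicit Types (S T U : psub n) (G : {set psub n}).

Lemma card_ord_gt0 : #|[set i : 'I_r.+1 | 0 < i]%N| = r.
Proof.
rewrite (_ : [set i : 'I_r.+1 | 0 < i]%N = [set~ ord0]) ?cardsC1 ?card_ord //.
by apply/setP => i; rewrite !inE -lt0n.
Qed.

Lemma flag_rank_surj (M : matroid 'I_n.+1 r.+1) G : loopless M ->
    chain_set G -> {in G, forall S, flat M (val S)} -> #|G| = r ->
  forall i, (0 < i <= r)%N -> exists2 S, S \in G & M (val S) = i.
Proof.
move=> lM cG fG cardG i hi.
have : flat_ranks M G == [set i : 'I_r.+1 | 0 < i]%N.
  by rewrite eqEcard flat_ranks_gt0 //= card_ord_gt0 card_flat_ranks // cardG.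
move=> /eqP/setP/(_ (inord i)); rewrite !inE inordK; last by lia.
by case: (andP hi) => -> _ /exists_inP[S hS /eqP <-]; exists S.
Qed.

End FlagRanks.

Section ElementaryQuotient.
Variables (n r : nat).
Implicit Types (S T U : psub n) (G : {set psub n}) (A B : {set 'I_n.+1}).

Lemma flag_gap (M : matroid 'I_n.+1 r.+2) G : loopless M ->
    chain_set G -> {in G, forall S, flat M (val S)} -> #|G| = r ->
  exists A B, [/\ flat M A /\ flat M B, M B = (M A).+2, A \subset B,
    (A = set0 \/ exists2 S, S \in G & A = val S) /\
    (B = setT \/ exists2 S, S \in G & B = val S) &
    {in G, forall T, val T \subset A \/ B \subset val T} /\
    (forall S, S \notin G -> [forall T in G, nested S T] -> flat M (val S) ->
      [/\ M (val S) = (M A).+1, A \subset val S & val S \subset B])].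
Proof.
move=> lM cG fG cardG.
have [p Hp] : exists p, [set i : 'I_r.+2 | 0 < i]%N :\: flat_ranks M G = [set p].
  apply/cards1P; rewrite cardsD (setIidPr (flat_ranks_gt0 lM fG)).
  by rewrite card_ord_gt0 card_flat_ranks // cardG subSnn.
have [p_gt0 p_notin] : (0 < p)%N /\ p \notin flat_ranks M G.
  by have := set11 p; rewrite -Hp !inE => /andP[-> ->].
have rank_in i : (0 < i < r.+2)%N -> i != p :> nat -> exists2 S, S \in G & M (val S) = i.
  move=> hi nip; have : inord i \notin [set p].
    by rewrite inE -(inj_eq val_inj) /= inordK //; case/andP: hi.
  rewrite -Hp !inE inordK; last by case/andP: hi.
  by case/andP: hi => -> _; rewrite andbT negbK => /exists_inP[S hS /eqP <-]; exists S.
have rank_neq S : S \in G -> M (val S) != p :> nat.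
  by move=> hS; apply: contra p_notin => eqp; rewrite inE; apply/exists_inP; exists S.
have ltp := ltn_ord p.
have [A [fA rA bA]] : exists A, [/\ flat M A, M A = p.-1 &
    A = set0 \/ exists2 S, S \in G & A = val S].
  case: (ltnP 1 p) => hp.
    have [||S hS rS] := rank_in p.-1; [lia|lia|].
    by exists (val S); split; [apply: fG | | right; exists S].
  exists set0; split; [exact: loopless_flat0 | rewrite matroid_rk0; lia | by left].
have [B [fB rB bB]] : exists B, [/\ flat M B, M B = p.+1 &
    B = setT \/ exists2 S, S \in G & B = val S].
  case: (ltnP p r.+1) => hp.
    have [||S hS rS] := rank_in p.+1; [lia|lia|].
    by exists (val S); split; [apply: fG | | right; exists S].
  exists setT; split; [exact: flat_setT | rewrite rk_setT; lia | by left].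
have above T : flat M (val T) -> [forall U in G, nested T U] -> (p <= M (val T))%N -> A \subset val T.
  move=> fT /forall_inP nT leT; case: bA => [->|[S hS eA]]; first exact: sub0set.
  have /orP[sTS|] := nT S hS; last by rewrite eA.
  by have := leq_trans leT (rk_mono M sTS); rewrite -eA rA -ltnS prednK ?ltnn.
have below T : flat M (val T) -> [forall U in G, nested T U] -> (M (val T) <= p)%N -> val T \subset B.
  move=> fT /forall_inP nT leT; case: bB => [->|[S hS eB]]; first exact: subsetT.
  have /orP[|sTS] := nT S hS; first by rewrite eB.
  by have := leq_trans (rk_mono M sTS) leT; rewrite -eB rB ltnn.
have nestG T : T \in G -> [forall U in G, nested T U].
  by move=> hT; apply/forall_inP => U hU; apply: (chain_setP _ cG).
exists A, B; split=> //; first by rewrite rA rB; lia.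
  case: bA => [->|[S hS eA]]; first exact: sub0set.
  rewrite eA; apply: below; [exact: fG | exact: nestG | by rewrite -eA rA leq_pred].
split=> [T hT|S nS nestS fS].
  have := rank_neq T hT; rewrite neq_ltn => /orP[ltT|ltT]; [left|right].
    case: bA => [eA|[S hS eA]].
      have /andP[T_gt0 _] := flat_psub_rk lM (fG T hT).
      move: rA; rewrite eA matroid_rk0 => p0.
      by move: ltT; rewrite -(prednK p_gt0) -p0 ltnNge T_gt0.
    by rewrite eA; apply: (chain_flat_sub cG fG) => //; rewrite -eA rA -ltnS prednK.
  case: bB => [eB|[S hS eB]].
    have /andP[_] := flat_psub_rk lM (fG T hT).
    by move: rB; rewrite eB rk_setT => -[eqp] leTr; move: ltT; rewrite -eqp ltnNge -ltnS leTr.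
  by rewrite eB; apply: (chain_flat_sub cG fG) => //; rewrite -eB rB.
have rS : M (val S) = p.
  apply/eqP; apply: contraR nS => nSp.
  have [T hT eT] := rank_in _ (flat_psub_rk lM fS) nSp.
  suff -> : S = T by [].
  have cSG : chain_set (S |: G) by rewrite chain_setU1 cG.
  apply: (chain_flat_rk_inj (M := M) cSG) => //; rewrite ?inE ?eqxx ?hT ?orbT //.
  by move=> U; rewrite !inE => /predU1P[->//|/fG].
by rewrite rS rA prednK // above ?below ?rS.
Qed.

Variables (M : matroid 'I_n.+1 r.+2) (M' : matroid 'I_n.+1 r.+1).
Hypotheses (lM' : loopless M')
  (le_M'M : forall A, (M' A <= M A)%N) (le_MM' : forall A, (M A <= (M' A).+1)%N)
  (quot : forall A B, A \subset B -> (M' B + M A <= M B + M' A)%N).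

Lemma quotient_loopless : loopless M.
Proof.
move=> e; have := le_M'M [set e]; have := rk_le_card M [set e].
by rewrite lM' cards1; lia.
Qed.

Lemma quotient_flat A : flat M' A -> flat M A.
Proof.
move=> /flatP fA; apply/flatP => e he.
by have := quot (subsetU1 e A); have := fA e he; lia.
Qed.

Lemma quotient_drop_mono A B : A \subset B -> (M' A < M A)%N -> (M' B < M B)%N.
Proof. by move=> /quot; lia. Qed.

(* The left-hand side is the weight of the flag G in the tropical divisor of the
   rank-drop function M - M' on the Bergman fan of M, normalized at a. *)
Lemma quotient_multiplicity G (a : 'I_n.+1) :
    chain_set G -> {in G, forall S, flat M (val S)} -> #|G| = r ->
    {in G, forall S, (a \in val S) = (M' (val S) < M (val S))%N} ->
  \sum_(S | (S \notin G) && [forall T in G, nested S T] && flat M (val S))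
     ((a \in val S)%:R - (M' (val S) < M (val S))%N%:R : rat)
  = [forall S in G, flat M' (val S)]%:R.
Proof.
move=> cG fG cardG ha; have lM := quotient_loopless.
have [A [B [[fA fB] rB sAB [bA bB] [GAB mid]]]] := flag_gap lM cG fG cardG.
have aA : (a \in A) = (M' A < M A)%N.
  case: bA => [->|[S hS ->]]; last exact: ha.
  by rewrite inE !matroid_rk0.
have aB : (a \in B) = (M' B < M B)%N.
  case: bB => [->|[S hS ->]]; last exact: ha.
  by rewrite inE !rk_setT leqnn.
have flats' i : {in G, forall S, flat M' (val S)} -> (0 < i <= r)%N ->
    exists2 S, S \in G & M' (val S) = i.
  by move=> fG'; apply: flag_rank_surj.
have skip i : {in G, forall S, flat M' (val S)} -> (0 < i <= r)%N ->
    (M' A < i < M' B)%N -> False.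
  move=> fG' hi ltAiB; have [S hS eS] := flats' i fG' hi.
  case/andP: ltAiB => ltAi ltiB.
  by case: (GAB S hS) => /(rk_mono M'); rewrite eS leqNgt ?ltAi ?ltiB.
have [leA lA] := (le_M'M A, le_MM' A); have [leB lB] := (le_M'M B, le_MM' B).
have [dA|ndA] := boolP (M' A < M A)%N.
  rewrite big1; last first.
    move=> S /andP[/andP[nS nestS] fS]; have [_ sAS _] := mid S nS nestS fS.
    by rewrite (subsetP sAS) ?aA // (quotient_drop_mono sAS dA) subrr.
  have := quotient_drop_mono sAB dA; have := rk_le M B => leBr dB.
  case: forall_inP => // fG'.
  by case: (skip (M' A).+1 fG'); clear -dA lA leA lB leB rB leBr dB; lia.
have [dB|ndB] := boolP (M' B < M B)%N; last first.
  rewrite big1; last first.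
    move=> S /andP[/andP[nS nestS] fS]; have [_ _ sSB] := mid S nS nestS fS.
    have -> : a \in val S = false.
      by apply: contraNF ndB => /(subsetP sSB); rewrite aB.
    case: ltnP => // dS; first by rewrite (quotient_drop_mono sSB dS) in ndB.
  have := rk_le M' B => leBr.
  case: forall_inP => // fG'.
  by case: (skip (M' A).+1 fG'); clear -ndA lA leA lB leB rB leBr ndB; lia.
rewrite dB in aB; rewrite (negbTE ndA) in aA.
pose F0 := mclosure M (a |: A).
have rF0 : M F0 = (M A).+1.
  rewrite rk_closure; apply/eqP; rewrite eqn_leq rk_setU1.
  by apply: (flatP _ _ fA); rewrite aA.
have sF0B : F0 \subset B by apply: closure_sub => //; rewrite subUset sub1set aB.
have sAF0 : A \subset F0 by apply: subset_trans (sub_closure _ _); apply: subsetU1.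
have aF0 : a \in F0 by apply: (subsetP (sub_closure M _)); rewrite setU11.
have psubP F : M F = (M A).+1 -> F \subset B -> (F != set0) && (F != setT).
  move=> rF sFB; apply/andP; split; apply/eqP => eF; rewrite eF in rF.
    by rewrite matroid_rk0 in rF.
  move: sFB; rewrite eF subTset => /eqP eB.
  by have /eqP := rB; rewrite eB rF eqSS ltn_eqF.
have inC F (rF : M F = (M A).+1) (sFB : F \subset B) (sAF : A \subset F) (fF : flat M F)
    (S := Sub F (psubP F rF sFB) : psub n) :
    (S \notin G) && [forall T in G, nested S T] && flat M (val S).
  rewrite /= fF andbT; apply/andP; split.
    apply/negP => hS; by case: (GAB S hS) => /(rk_mono M) /=; rewrite rF ?rB ltnn.
  apply/forall_inP => T /GAB[sTA|sBT]; rewrite /nested /=.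
    by rewrite (subset_trans sTA sAF) orbT.
  by rewrite (subset_trans sFB sBT).
rewrite sumrB.
pose S0 : psub n := Sub F0 (psubP F0 rF0 sF0B).
rewrite (bigD1 S0) /=; last by rewrite inC // flat_closure.
rewrite aF0 big1 ?addr0; last first.
  move=> S /andP[/andP[/andP[nS nestS] fS] nSS0].
  have [rS sAS sSB] := mid S nS nestS fS.
  case aS: (a \in val S) => //; case/eqP: nSS0; apply: val_inj => /=.
  apply/esym/flat_eq; [exact: flat_closure | | by rewrite rS -rF0].
  by apply: closure_sub => //; rewrite subUset sub1set aS.
case: (pickP [pred S | (S \notin G) && [forall T in G, nested S T] && flat M (val S)
    && (M' (val S) < M (val S))%N]) => [S1 /= /andP[C1 d1]|none].
  rewrite (bigD1 S1) //= d1 big1 ?addr0 ?subrr; last first.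
    move=> S /andP[/andP[/andP[nS nestS] fS] nSS1].
    have [rS sAS sSB] := mid S nS nestS fS.
    case/andP: C1 => /andP[nS1 nestS1] fS1.
    have [rS1 sAS1 sS1B] := mid S1 nS1 nestS1 fS1.
    case: ltnP => // dS; case/eqP: nSS1; apply: val_inj.
    have sub' := rk_submod M' (val S) (val S1).
    have sAI : A \subset val S :&: val S1 by rewrite subsetI sAS.
    have := rk_mono M' sAI; have := le_MM' (val S :|: val S1).
    move=> leU leI.
    have eU : (M (val S :|: val S1) <= (M A).+1)%N.
      apply: leq_trans leU _; rewrite ltnS -(leq_add2r (M' (val S :&: val S1))).
      apply: leq_trans sub' _; rewrite rS ltnS in dS; rewrite rS1 ltnS in d1.
      by apply: leq_add dS (leq_trans d1 (leq_trans _ leI)); rewrite leqNgt.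
    have eS := flat_eq fS (subsetUl _ (val S1)).
    have eS1 := flat_eq fS1 (subsetUr (val S) _).
    by apply: etrans (eS _) (esym (eS1 _)); rewrite ?rS ?rS1.
  case/andP: C1 => /andP[nS1 nestS1] fS1; have [rS1 sAS1 sS1B] := mid S1 nS1 nestS1 fS1.
  case: forall_inP => // fG'.
  have fA' : flat M' A by case: bA => [->|[S hS ->]]; [exact: loopless_flat0 | exact: fG'].
  suff eA1 : A = val S1 by move: rS1; rewrite -eA1 => /n_Sn.
  rewrite rS1 ltnS in d1; apply: (flat_eq fA') => //.
  by apply: leq_trans d1 _; rewrite leqNgt.
rewrite [X in _ - X]big1 ?subr0; last first.
  by move=> S hS; have := none S; rewrite /= hS /= => ->.
suff -> : [forall S in G, flat M' (val S)] by [].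
apply/forall_inP => T hT; apply/flatP => e he.
have MT : (M (val T) < M (e |: val T))%N := flatP _ _ (fG T hT) e he.
have lT := le_M'M (val T); have lT' := le_MM' (val T).
have leT := le_M'M (e |: val T); have leT' := le_MM' (e |: val T).
rewrite ltnNge; apply/negP => geT0.
have {geT0}geT : (M' (e |: val T) <= M' (val T))%N := geT0.
have ndT : (M' (val T) < M (val T))%N = false.
  by apply/negP => dT; clear -dT MT leT' geT; lia.
have sTA : val T \subset A.
  by case: (GAB T hT) => // /quotient_drop_mono /(_ dB); rewrite ndT.
have deT : (M' (e |: val T) < M (e |: val T))%N by clear -geT lT MT; lia.
have eA : e \notin A.
  apply: contra ndA => eA; apply: quotient_drop_mono deT.
  by rewrite subUset sub1set eA.
have M'eA : (M' (e |: A) <= M' A)%N by have := rk_submodU1 M' e sTA; clear -geT; lia.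
have MeA : M (e |: A) = (M A).+1.
  by apply/eqP; rewrite eqn_leq rk_setU1 (flatP _ _ fA).
have [eB|eB] := boolP (e \in B).
  pose F := mclosure M (e |: A).
  have rF : M F = (M A).+1 by rewrite rk_closure.
  have sFB : F \subset B by apply: closure_sub => //; rewrite subUset sub1set eB.
  have sAF : A \subset F by apply: subset_trans (sub_closure _ _); apply: subsetU1.
  have := none (Sub F (psubP F rF sFB)); rewrite /= inC ?flat_closure //=.
  by rewrite (quotient_drop_mono (sub_closure M (e |: A))) // MeA ltnS (leq_trans M'eA).
have MeB := flatP _ _ fB e eB; have M'eB := rk_submodU1 M' e sAB.
by have := le_MM' (e |: B); clear -MeB M'eB M'eA dB; lia.
Qed.

End ElementaryQuotient.

Section BergmanClass.
Variable n : nat.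
Implicit Types (S T U : psub n) (G : {set psub n}) (A B : {set 'I_n.+1}).

Definition bergman_class r (M : matroid 'I_n.+1 r.+1) (X : chow n) :=
  forall G, chain_set G -> #|G| = r ->
  chow_deg (X * \prod_(S in G) x_ S) = [forall S in G, flat M (val S)]%:R.

Definition drop_divisor r (M : matroid 'I_n.+1 r.+2) (M' : matroid 'I_n.+1 r.+1) : chow n :=
  \sum_(S : psub n) chow_scale ((ord0 \in val S)%:R - (M' (val S) < M (val S))%N%:R) (x_ S).

Lemma chow_scale_sum_mem (a : 'I_n.+1) :
  \sum_(S : psub n) chow_scale (a \in val S)%:R (x_ S) = \sum_(S : psub n | a \in val S) x_ S.
Proof.
rewrite [RHS]big_mkcond; apply: eq_bigr => S _.
by case: (a \in val S); rewrite ?chow_scale1 ?chow_scale0.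
Qed.

Lemma drop_divisor_shift r (M : matroid 'I_n.+1 r.+2) (M' : matroid 'I_n.+1 r.+1) a :
  drop_divisor M M' =
  \sum_(S : psub n) chow_scale ((a \in val S)%:R - (M' (val S) < M (val S))%N%:R) (x_ S).
Proof.
rewrite /drop_divisor.
under eq_bigr => S _ do rewrite chow_scaleDl.
under [RHS]eq_bigr => S _ do rewrite chow_scaleDl.
by rewrite !big_split /= !chow_scale_sum_mem (x_lin ord0 a).
Qed.

Lemma bergman_class_quotient r (M : matroid 'I_n.+1 r.+2) (M' : matroid 'I_n.+1 r.+1) X :
    loopless M' -> (forall A, (M' A <= M A)%N) -> (forall A, (M A <= (M' A).+1)%N) ->
    (forall A B, A \subset B -> (M' B + M A <= M B + M' A)%N) ->
  bergman_class M X -> bergman_class M' (X * drop_divisor M M').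
Proof.
move=> lM' le1 le2 quot HX G cG cardG.
have [a ha] : exists a, {in G, forall S, (a \in val S) = (M' (val S) < M (val S))%N}.
  by apply: chain_separate cG _ => S T _ _; apply: quotient_drop_mono.
rewrite (drop_divisor_shift _ _ a) mulr_sumr mulr_suml raddf_sum /=.
have term S : chow_deg (X * chow_scale ((a \in val S)%:R - (M' (val S) < M (val S))%N%:R) (x_ S)
      * \prod_(T in G) x_ T)
    = ((a \in val S)%:R - (M' (val S) < M (val S))%N%:R)
      * chow_deg (X * (x_ S * \prod_(T in G) x_ T)).
  by rewrite -chow_deg_scale /chow_scale; congr chow_deg; ring.
rewrite (eq_bigr _ (fun S _ => term S)).
have deg S : S \notin G -> chow_deg (X * (x_ S * \prod_(T in G) x_ T))
    = ([forall T in G, nested S T] && flat M (val S) && [forall T in G, flat M (val T)])%:R.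
  move=> hS; case: (boolP [forall T in G, nested S T]) => [nest|].
    rewrite -prod_setU1 // HX ?chain_setU1 ?cG ?cardsU1 ?hS ?cardG //.
    congr (nat_of_bool _)%:R; apply/forall_inP/andP => [h|[fS /forall_inP fG] T].
      split; first by apply: h; rewrite setU11.
      by apply/forall_inP => T hT; apply: h; rewrite setU1r.
    by rewrite !inE => /predU1P[->//|/fG].
  case/forall_inPn => U hU nSU.
  by rewrite (bigD1 U) //= [x_ S * _]mulrA x_mul_incomparable // mul0r mulr0 raddf0.
rewrite (bigID (mem G)) /= big1 ?add0r => [|S hS]; last by rewrite ha // subrr mul0r.
rewrite (eq_bigr _ (fun S hS => congr1 _ (deg S hS))).
case: (boolP [forall T in G, flat M (val T)]) => [/forall_inP fG|nfG]; last first.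
  rewrite big1 => [|S _]; last by rewrite andbF mulr0.
  case: (boolP [forall T in G, flat M' (val T)]) => // /forall_inP fG'.
  case/negP: nfG; apply/forall_inP => T hT.
  exact: (quotient_flat quot (fG' T hT)).
rewrite -(quotient_multiplicity lM' le1 le2 quot cG fG cardG ha).
rewrite [RHS]big_mkcond [LHS]big_mkcond /=; apply: eq_bigr => S _.
by case: (S \notin G); rewrite //= andbT; case: (_ && _); rewrite ?mulr1 ?mulr0.
Qed.

Lemma bergman_class_ex m r (M : matroid 'I_n.+1 r.+1) : loopless M -> n = (r + m)%N ->
  exists2 X, chow_graded m X & bergman_class M X.
Proof.
elim: m r M => [|m IHm] r M lM en.
  rewrite addn0 in en; exists 1; first exact: chow_graded1.
  move=> G cG cardG; rewrite mul1r chow_deg_chain //; last by rewrite cardG.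
  have rkE A : M A = #|A|.
    apply/eqP; rewrite eqn_leq rk_le_card /=.
    have := rk_le_addD M (subsetT A); rewrite rk_setT setTD => h.
    have cardE : (#|A| + #|~: A| = r.+1)%N by rewrite cardsC card_ord en.
    by rewrite -(leq_add2r #|~: A|) cardE.
  suff -> : [forall S in G, flat M (val S)] by [].
  apply/forall_inP => S _; apply/flatP => e he.
  by rewrite !rkE cardsU1 he.
have ltr : (r.+1 < #|'I_n.+1|)%N by rewrite card_ord; lia.
have [X gX HX] : exists2 X, chow_graded m X & bergman_class (higgs M ltr) X.
  by apply: IHm; [exact: higgs_loopless | rewrite en addSnnS].
exists (X * drop_divisor (higgs M ltr) M).
  rewrite -addn1; apply: chow_gradedM => //; apply: chow_graded_sum => S _.
  exact: chow_graded_x.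
apply: bergman_class_quotient => //= A; rewrite /higgs_rk.
- by rewrite leq_min rk_le_card leqnSn.
- exact: geq_minr.
- move=> B sAB; have := rk_le_addD M sAB; have := subset_leq_card sAB.
  have := rk_mono M sAB; rewrite cardsD (setIidPr sAB); lia.
Qed.

Lemma rank_le_card r (M : matroid 'I_n.+1 r.+1) : (r <= n)%N.
Proof.
by have := rk_le_card M setT; rewrite rk_setT cardsT card_ord.
Qed.

Lemma matroid_class_spec r (M : matroid 'I_n.+1 r.+1) : loopless M ->
  is_matroid_class M (matroid_class M).
Proof.
move=> lM; apply: epsilon_spec.
have [X gX HX] := bergman_class_ex lM (esym (subnKC (rank_le_card M))).
exists X; split=> // F cF; have [_ cG cardG] := is_chain_set cF.
rewrite degree_map_top; last first.
  have := chow_gradedM gX (chow_graded_monomial F).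
  by rewrite size_tuple subnK // (rank_le_card M).
rewrite chow_monomial_chain // HX //; last by rewrite cardG size_tuple.
have -> : [forall S in [set S in F], flat M (val S)] = all (fun S : psub n => flat M (val S)) F.
  apply/forall_inP/allP => h S; first by move=> hS; apply: h; rewrite inE.
  by rewrite inE; apply: h.
by case: ifP.
Qed.

End BergmanClass.

(** * Invariant divisors *)

Section KlyachkoRelations.
Variable n : nat.
Implicit Types (S T : psub n) (A : {set 'I_n.+1}) (c : psub n -> rat) (K s : seq nat).

Definition lin_comb c : chow n := \sum_(S : psub n) chow_scale (c S) (x_ S).

Lemma eq_lin_comb c c' : c =1 c' -> lin_comb c = lin_comb c'.
Proof. by move=> eq_c; apply: eq_bigr => S _; rewrite eq_c. Qed.

Lemma lin_combD c c' : lin_comb c + lin_comb c' = lin_comb (fun S => c S + c' S).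
Proof. by rewrite -big_split; apply: eq_bigr => S _; rewrite chow_scaleDl. Qed.

Lemma lin_combZ q c : chow_scale q (lin_comb c) = lin_comb (fun S => q * c S).
Proof. by rewrite {1}/chow_scale mulr_sumr; apply: eq_bigr => S _; apply: chow_scaleA. Qed.

Lemma lin_combN c : - lin_comb c = lin_comb (fun S => - c S).
Proof. by rewrite -chow_scaleN1 lin_combZ; apply: eq_lin_comb => S; rewrite mulN1r. Qed.

Lemma lin_comb0 : lin_comb (fun=> 0) = 0.
Proof. by rewrite /lin_comb big1 // => S _; rewrite chow_scale0. Qed.

Lemma chow_scale_sumr (I : Type) (l : seq I) (P : pred I) q (F : I -> chow n) :
  chow_scale q (\sum_(i <- l | P i) F i) = \sum_(i <- l | P i) chow_scale q (F i).
Proof. exact: mulr_sumr. Qed.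

Lemma chow_scaleAl q (x y : chow n) : chow_scale q x * y = chow_scale q (x * y).
Proof. by rewrite /chow_scale mulrA. Qed.

Lemma chow_scaleAr q (x y : chow n) : x * chow_scale q y = chow_scale q (x * y).
Proof. by rewrite /chow_scale mulrCA. Qed.

(* Both sides represent |A| times the hyperplane class. *)
Lemma lin_comb_cardI A :
  lin_comb (fun S => #|A :&: val S|%:R)
  = lin_comb (fun S => if ord_max \in val S then #|A|%:R else 0).
Proof.
have -> : lin_comb (fun S => #|A :&: val S|%:R)
    = \sum_(a in A) lin_comb (fun S => (a \in val S)%:R).
  rewrite exchange_big /=; apply: eq_bigr => S _.
  transitivity (chow_scale (\sum_(a in A) (a \in val S)%:R) (x_ S)).
    congr (chow_scale _ _); rewrite -natr_sum; congr _%:R.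
    by rewrite -sum1_card big_mkcond /= [RHS]big_mkcond; apply: eq_bigr => a _;
       rewrite inE; case: (a \in A); case: (a \in _).
  by elim/big_ind2: _ => [|? ? ? ? <- <-|//]; rewrite ?chow_scale0 ?chow_scaleDl.
transitivity (\sum_(a in A) lin_comb (fun S => (ord_max \in val S)%:R)).
  by apply: eq_bigr => a _; rewrite /lin_comb !chow_scale_sum_mem (x_lin a ord_max).
have -> : lin_comb (fun S => if ord_max \in val S then #|A|%:R else 0)
    = chow_scale #|A|%:R (lin_comb (fun S => (ord_max \in val S)%:R)).
  by rewrite lin_combZ; apply: eq_lin_comb => S; case: ifP; rewrite ?mulr1 ?mulr0.
rewrite sumr_const; elim: #|A| => [|m IHm]; first by rewrite mulr0n chow_scale0.
by rewrite mulrS IHm -[m.+1]addn1 natrD addrC chow_scaleDl chow_scale1.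
Qed.

(* The divisor L_{n+1-m} of the paper, pulled back from the m-th hypersimplex. *)
Definition hyper m : chow n :=
  lin_comb (fun S => (minn m #|val S|)%:R - (if ord_max \in val S then m%:R else 0)).

Lemma hyper_card A :
  hyper #|A| = lin_comb (fun S => (minn #|A| #|val S|)%:R - #|A :&: val S|%:R).
Proof.
rewrite /hyper -lin_combD -[RHS]lin_combD; congr (_ + _).
by rewrite -!lin_combN lin_comb_cardI.
Qed.

Lemma hyper0 : hyper 0 = 0.
Proof.
rewrite -(cards0 'I_n.+1) hyper_card -lin_comb0; apply: eq_lin_comb => S.
by rewrite cards0 min0n set0I cards0 subrr.
Qed.

Lemma hyper_top : hyper n.+1 = 0.
Proof.
rewrite -(card_ord n.+1) -cardsT hyper_card -lin_comb0; apply: eq_lin_comb => S.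
by rewrite setTI (minn_idPr _) ?subrr // subset_leq_card ?subsetT.
Qed.

Lemma x_hyper S : x_ S * hyper #|val S| = 0.
Proof.
rewrite hyper_card mulr_sumr big1 // => T _; rewrite chow_scaleAr.
have [/orP[sST|sTS]|/x_mul_incomparable ->] := boolP (nested S T).
- by rewrite (setIidPl sST) (minn_idPl (subset_leq_card sST)) subrr chow_scale0.
- by rewrite (setIidPr sTS) (minn_idPr (subset_leq_card sTS)) subrr chow_scale0.
- by rewrite /chow_scale mulr0.
Qed.

Definition level k : chow n := \sum_(S : psub n | #|val S| == k) x_ S.

Lemma levelE k : level k = lin_comb (fun S => (#|val S| == k)%:R).
Proof.
rewrite /level big_mkcond; apply: eq_bigr => S _.
by case: eqP => _; rewrite ?chow_scale1 ?chow_scale0.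
Qed.

Lemma level_hyper k : level k * hyper k = 0.
Proof.
by rewrite mulr_suml big1 // => S /eqP <-; apply: x_hyper.
Qed.

Lemma level_second_difference k : (0 < k)%N ->
  level k = hyper k + hyper k - hyper k.-1 - hyper k.+1.
Proof.
case: k => // k _; rewrite levelE /hyper !lin_combN !lin_combD; apply: eq_lin_comb => S.
have h : ((#|val S| == k.+1) + minn k #|val S| + minn k.+2 #|val S|
    = minn k.+1 #|val S| + minn k.+1 #|val S|)%N by lia.
have {}h : (#|val S| == k.+1)%:R = (minn k.+1 #|val S|)%:R + (minn k.+1 #|val S|)%:R
    - (minn k #|val S|)%:R - (minn k.+2 #|val S|)%:R :> rat.
  by rewrite -natrD -h !natrD; ring.
by rewrite h /= [k.+2%:R]mulrSr [k.+1%:R]mulrSr; case: ifP => _; ring.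
Qed.

Lemma sum_level (f : nat -> rat) :
  \sum_(j < n.+1) chow_scale (f j) (level j) = lin_comb (fun S => f #|val S|).
Proof.
rewrite [RHS](partition_big (@psub_card n) xpredT) //=; apply: eq_bigr => j _.
rewrite /level chow_scale_sumr; apply: eq_big => [S|S /eqP <-] //.
Qed.

Lemma hyper_interpolate (a m b : nat) : (a < m < b)%N ->
  exists2 f : nat -> rat, (forall j, ~~ (a < j < b)%N -> f j = 0) &
  chow_scale (b%:R - a%:R) (hyper m) =
    chow_scale (b%:R - m%:R) (hyper a) + chow_scale (m%:R - a%:R) (hyper b)
    + \sum_(j < n.+1) chow_scale (f j) (level j).
Proof.
move=> ltamb.
pose f j : rat := (b%:R - a%:R) * (minn m j)%:R - (b%:R - m%:R) * (minn a j)%:R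
  - (m%:R - a%:R) * (minn b j)%:R.
exists f.
  move=> j; rewrite /f negb_and -!leqNgt => /orP[leja|lebj].
    rewrite !(minn_idPr _) //; try lia; ring.
  rewrite !(minn_idPl _) //; try lia; ring.
rewrite (sum_level f) !lin_combZ !lin_combD /f; apply: eq_lin_comb => S.
by case: ifP => _; ring.
Qed.

Lemma level_interpolate K m : all (fun k => 0 < k < n.+1)%N K -> (m <= n.+1)%N ->
  exists d : rat, d != 0 /\ exists2 f : nat -> rat,
    (forall j, f j != 0 -> (j \notin K) && (0 < j < n.+1)%N) &
    chow_scale d (\prod_(k <- K) level k * hyper m)
    = \sum_(j < n.+1) chow_scale (f j) (\prod_(k <- K) level k * level j).
Proof.
move=> hK hm; set LK := \prod_(k <- K) level k.
pose knot k := [|| k == 0%N, k == n.+1 | k \in K].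
have LKknot k : knot k -> LK * hyper k = 0.
  case/or3P => [/eqP ->|/eqP ->|hk]; rewrite ?hyper0 ?hyper_top ?mulr0 //.
  by rewrite /LK (big_rem k) //= mulrAC level_hyper mul0r.
case: (boolP (knot m)) => [km|nkm].
  exists 1; split; first exact: oner_neq0.
  exists (fun=> 0) => [j|]; first by rewrite eqxx.
  rewrite LKknot // big1 => [|j _]; last by rewrite chow_scale0.
  by rewrite /chow_scale mulr0.
have ex_a : exists i, knot i && (i <= m)%N by exists 0%N; rewrite /knot eqxx.
have bd_a i : knot i && (i <= m)%N -> (i <= m)%N by case/andP.
case: (ex_maxnP ex_a bd_a) => a /andP[ka leam] max_a.
have ex_b : exists i, knot i && (m <= i)%N by exists n.+1; rewrite /knot eqxx orbT.
case: (ex_minnP ex_b) => b /andP[kb lemb] min_b.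
have ltam : (a < m)%N.
  by rewrite ltn_neqAle leam andbT; apply: contraNneq nkm => <-.
have ltmb : (m < b)%N.
  by rewrite ltn_neqAle lemb andbT; apply: contraNneq nkm => ->.
have lebn : (b <= n.+1)%N by apply: min_b; rewrite /knot eqxx orbT.
have [f f0 ef] : exists2 f : nat -> rat, (forall j, ~~ (a < j < b)%N -> f j = 0) & _
  := hyper_interpolate (introT andP (conj ltam ltmb)).
exists (b%:R - a%:R); split; first by rewrite subr_eq0 eqr_nat; lia.
exists f.
  move=> j; apply: contraR => nj; rewrite f0 //; apply: contra nj => /andP[ltaj ltjb].
  have nkj : ~~ knot j.
    apply/negP => kj; case: (leqP j m) => [lejm|ltmj].
      by have := max_a j; rewrite kj lejm leqNgt ltaj => /(_ isT).
    by have := min_b j; rewrite kj (ltnW ltmj) leqNgt ltjb => /(_ isT).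
  by move: nkj; rewrite !negb_or => /and3P[_ _ ->] /=; lia.
rewrite -chow_scaleAr ef !mulrDr !chow_scaleAr !LKknot // /chow_scale !mulr0 !add0r.
rewrite mulr_sumr; apply: eq_bigr => j _; exact: mulrCA.
Qed.

Variables (r : nat) (Z : chow n).

Lemma chow_deg_hyper_prod :
    (forall K, uniq K -> all (fun k => 0 < k < n.+1)%N K -> size K = r ->
       chow_deg (Z * \prod_(k <- K) level k) = 0) ->
  forall s, all (fun m => m <= n.+1)%N s -> size s = r ->
    chow_deg (Z * \prod_(m <- s) hyper m) = 0.
Proof.
move=> H s hs size_s.
suff main K : uniq K -> all (fun k => 0 < k < n.+1)%N K -> (size K + size s)%N = r ->
    chow_deg (Z * (\prod_(k <- K) level k * \prod_(m <- s) hyper m)) = 0.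
  by have := main [::]; rewrite big_nil mul1r; apply.
elim: s hs {size_s} K => [|m s IHs] /= hs K uK hK size_K.
  by rewrite big_nil mulr1 H // -size_K addn0.
case/andP: hs => hm hs; rewrite big_cons.
have [d [d0 [f hf ef]]] := level_interpolate hK hm.
apply: (mulfI d0); rewrite mulr0 -chow_deg_scale -chow_scaleAr.
rewrite [_ * (hyper m * _)]mulrA -chow_scaleAl ef mulr_suml mulr_sumr raddf_sum big1 //= => j _.
rewrite chow_scaleAl chow_scaleAr chow_deg_scale.
have [->|/hf /andP[jK hj]] := eqVneq (f j) 0; first by rewrite mul0r.
have -> : \prod_(k <- K) level k * level j = \prod_(k <- (j : nat) :: K) level k.
  by rewrite big_cons mulrC.
by rewrite IHs ?mulr0 //= ?jK ?hj // -size_K addnS.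
Qed.

Lemma chow_deg_level_prod :
    (forall s, all (fun m => 0 < m < n.+1)%N s -> size s = r ->
       chow_deg (Z * \prod_(m <- s) hyper m) = 0) ->
  forall K, all (fun k => 0 < k < n.+1)%N K -> size K = r ->
    chow_deg (Z * \prod_(k <- K) level k) = 0.
Proof.
move=> H K hK size_K.
suff main s : all (fun m => m <= n.+1)%N s -> (size K + size s)%N = r ->
    chow_deg (Z * (\prod_(k <- K) level k * \prod_(m <- s) hyper m)) = 0.
  by have := main [::]; rewrite big_nil mulr1 addn0; apply.
elim: K hK {size_K} s => [|k K IHK] /= hK s hs size_s.
  rewrite big_nil mul1r; case: (boolP (all (fun m => 0 < m < n.+1)%N s)) => [|/allPn[m ms nm]].
    by move=> hs'; apply: H.
  suff -> : \prod_(m <- s) hyper m = 0 by rewrite mulr0 raddf0.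
  rewrite (big_rem m) //=; suff -> : hyper m = 0 by rewrite mul0r.
  have lem := allP hs _ ms.
  have [->|->] : m = 0%N \/ m = n.+1 by lia.
    exact: hyper0.
  exact: hyper_top.
case/andP: hK => hk hK; rewrite big_cons.
have term j : (j <= n.+1)%N ->
    chow_deg (Z * (\prod_(k <- K) level k * \prod_(m <- j :: s) hyper m)) = 0.
  by move=> hj; apply: IHK => //=; rewrite ?hj // -size_s addnS.
have -> : Z * (level k * \prod_(k <- K) level k * \prod_(m <- s) hyper m)
  = Z * (\prod_(k <- K) level k * \prod_(m <- k :: s) hyper m)
  + Z * (\prod_(k <- K) level k * \prod_(m <- k :: s) hyper m)
  - Z * (\prod_(k <- K) level k * \prod_(m <- k.-1 :: s) hyper m)
  - Z * (\prod_(k <- K) level k * \prod_(m <- k.+1 :: s) hyper m).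
  rewrite !big_cons level_second_difference; last by case/andP: hk.
  ring.
rewrite !raddfB raddfD /= !term ?subr0 ?addr0 //; lia.
Qed.

End KlyachkoRelations.

(** * Flags of flats and the G-invariant *)

Section CatenaryData.
Variables (n r : nat).
Implicit Types (F : {ffun 'I_r -> psub n}) (k : {ffun 'I_r -> 'I_n.+1}) (s w : 'S_n.+1).
Implicit Types (M : matroid 'I_n.+1 r.+1) (c : nat -> nat).

Definition is_flag F := [forall i : 'I_r, forall j : 'I_r, (i < j)%N ==> (val (F i) \proper val (F j))].

Lemma is_flagP F :
  reflect (forall i j : 'I_r, (i < j)%N -> val (F i) \proper val (F j)) (is_flag F).
Proof.
apply: (iffP forallP) => [h i j|h i]; first exact: (implyP (forallP (h i) j)).
by apply/forallP => j; apply/implyP; apply: h.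
Qed.

Definition flat_flag M F := is_flag F && [forall i, flat M (val (F i))].

Definition sizes F : {ffun 'I_r -> 'I_n.+1} := [ffun i => psub_card (F i)].

Definition catenary M k := #|[set F | flat_flag M F && (sizes F == k)]|.

Lemma is_flag_chain F : is_flag F -> chain_set [set F i | i : 'I_r].
Proof.
move=> /is_flagP hF; apply/chain_setP => _ _ /imsetP[i _ ->] /imsetP[j _ ->].
rewrite /nested; case: (ltngtP i j) => [/hF/proper_sub->|/hF/proper_sub->|/val_inj->] //.
  by rewrite orbT.
by rewrite subxx.
Qed.

Lemma sizes_is_flag F : is_flag F -> forall i j : 'I_r, (i < j)%N -> (sizes F i < sizes F j)%N.
Proof. by move=> /is_flagP hF i j /hF/proper_card; rewrite !ffunE. Qed.

Lemma chow_deg_level_catenary M (X : chow n) k :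
    (forall F : r.-tuple (psub n), is_chain F -> chow_deg (X * chow_monomial F)
      = if all (fun S : psub n => flat M (val S)) F then 1 else 0) ->
    (forall i j : 'I_r, (i < j)%N -> (k i < k j)%N) ->
  chow_deg (X * \prod_(i < r) level n (k i)) = (catenary M k)%:R.
Proof.
move=> HX incr_k.
rewrite /level (bigA_distr_big_dep (fun (i : 'I_r) (S : psub n) => #|val S| == k i)
  (fun (_ : 'I_r) (S : psub n) => x_ S)) /=.
rewrite mulr_sumr raddf_sum /=.
rewrite /catenary -sum1_card natr_sum big_mkcond [RHS]big_mkcond /=; apply: eq_bigr => F _.
rewrite [X in (if X then _ else 0) = _](_ : _ = (sizes F == k)); last first.
  apply/familyP/eqP => [h|<- i]; last by rewrite unfold_in /= ffunE.
  by apply/ffunP => i; apply: val_inj; rewrite ffunE /=; apply/eqP; apply: h.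
rewrite inE; case: (eqVneq (sizes F) k) => [eqk|_]; last by rewrite andbF.
rewrite andbT /flat_flag; case: (boolP (is_flag F)) => [fF|nF].
  have := HX [tuple F i | i < r] (is_chain_tuple (is_flagP _ fF)).
  rewrite /chow_monomial big_map big_enum /= => ->.
  suff -> : all (fun S : psub n => flat M (val S)) [seq F i | i <- enum 'I_r]
    = [forall i, flat M (val (F i))] by case: ifP.
  rewrite all_map; apply/allP/forallP => h i; first by apply: h; rewrite mem_enum.
  by move=> _; apply: h.
have [i [j [ltij nij]]] : exists i j : 'I_r, (i < j)%N /\ ~~ nested (F i) (F j).
  move: nF; rewrite negb_forall => /existsP[i]; rewrite negb_forall => /existsP[j].
  rewrite negb_imply => /andP[ltij nP]; exists i, j; split=> //.
  have ltc : (#|val (F i)| < #|val (F j)|)%N.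
    by have := incr_k _ _ ltij; rewrite -eqk !ffunE.
  rewrite /nested negb_or; apply/andP; split.
    by apply: contra nP => sub; rewrite properEcard sub.
  by apply: contraL ltc => /subset_leq_card; rewrite -leqNgt.
rewrite (bigD1 i) //= (bigD1 j) /=; last by apply: contraTneq ltij => ->; rewrite ltnn.
by rewrite [x_ _ * (_ * _)]mulrA x_mul_incomparable // mul0r mulr0 raddf0.
Qed.

(* The step of rank m of the flag completed by the empty set and the ground set. *)
Definition flag_set F (m : nat) : {set 'I_n.+1} :=
  if m is m'.+1 then (if insub m' is Some i then val (F i) else setT) else set0.

Lemma flag_setS F (i : 'I_r) : flag_set F i.+1 = val (F i).
Proof. by rewrite /= insubT //= => h; congr (val (F _)); apply: val_inj. Qed.

Lemma flag_set_top F m : (r < m)%N -> flag_set F m = setT.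
Proof. by case: m => // m; rewrite ltnS => h /=; rewrite insubF // ltnNge h. Qed.

Lemma flag_set_proper F m : is_flag F -> (m <= r)%N ->
  flag_set F m \proper flag_set F m.+1.
Proof.
move=> /is_flagP hF; case: m => [_|m ltm].
  rewrite proper0; case: (posnP r) => [r0|r_gt0].
    by rewrite flag_set_top ?r0 // -card_gt0 cardsT card_ord.
  by rewrite (flag_setS F (Ordinal r_gt0)); case/andP: (valP (F (Ordinal r_gt0))).
rewrite (flag_setS F (Ordinal ltm)).
have [lt|ge] := ltnP m.+1 r; first by rewrite (flag_setS F (Ordinal lt)); apply: hF => /=.
by rewrite flag_set_top // properT; case/andP: (valP (F (Ordinal ltm))).
Qed.

Lemma flag_set_mono F m m' : is_flag F -> (m <= m')%N -> flag_set F m \subset flag_set F m'.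
Proof.
move=> hF; elim: m' => [|m' IHm']; first by rewrite leqn0 => /eqP->.
rewrite leq_eqVlt => /predU1P[->//|/IHm' sub]; apply: subset_trans sub _.
have [le|gt] := leqP m' r; first exact: proper_sub (flag_set_proper hF le).
by rewrite !flag_set_top // ltnW.
Qed.

Lemma flag_set_flat M F m : loopless M -> flat_flag M F -> flat M (flag_set F m).
Proof.
move=> lM /andP[_ /forallP fF]; case: m => [|m]; first exact: loopless_flat0.
have [lt|ge] := ltnP m r; first by rewrite (flag_setS F (Ordinal lt)).
by rewrite flag_set_top //; apply: flat_setT.
Qed.

Lemma increasing_gap (f : nat -> nat) m i j :
  (forall l, (l < m)%N -> (f l < f l.+1)%N) -> (i <= j <= m)%N -> (f i + (j - i) <= f j)%N.
Proof.
move=> hf; elim: j => [|j IHj] /andP[]; first by rewrite leqn0 => /eqP->; rewrite addn0.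
rewrite leq_eqVlt => /predU1P[->|leij ltjm]; first by rewrite subnn addn0.
by have := hf j ltjm; have := IHj; rewrite -ltnS leij ltnW //= => /(_ isT); lia.
Qed.

Lemma flag_set_rk M F m : loopless M -> flat_flag M F -> (m <= r.+1)%N ->
  M (flag_set F m) = m.
Proof.
move=> lM ff lem; have /andP[hF _] := ff.
have incr l : (l < r.+1)%N -> (M (flag_set F l) < M (flag_set F l.+1))%N.
  by move=> ltl; apply: flat_rk_lt; [apply: flag_set_flat | apply: flag_set_proper].
have lo := increasing_gap incr (i := 0%N) (j := m) lem.
have up := increasing_gap incr (i := m) (j := r.+1).
rewrite lem leqnn (flag_set_top F (ltnSn r)) rk_setT in up.
apply/eqP; rewrite eqn_leq; apply/andP; split.
  by have {}up := up isT; rewrite -(leq_add2r (r.+1 - m)) [X in (_ <= X)%N]subnKC.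
by move: lo; rewrite matroid_rk0 add0n subn0.
Qed.

Definition compatible s F c :=
  [forall j : 'I_n.+1, (s j \in flag_set F (c j.+1))
    && ((c j < c j.+1)%N ==> (s j \notin flag_set F (c j)))].

Definition rank_profile c := [/\ c 0%N = 0%N, c n.+1 = r.+1 &
  forall j, (j < n.+1)%N -> (c j <= c j.+1 <= (c j).+1)%N].

Lemma profile_mono c i j : rank_profile c -> (i <= j <= n.+1)%N -> (c i <= c j)%N.
Proof.
case=> _ _ hc; elim: j => [|j IHj] /andP[]; first by rewrite leqn0 => /eqP->.
rewrite leq_eqVlt => /predU1P[->//|leij ltj].
have /andP[le1 _] := hc j ltj; apply: leq_trans le1.
by apply: IHj; rewrite -ltnS leij ltnW.
Qed.

Lemma profile_surj c v : rank_profile c -> (v <= r.+1)%N ->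
  exists2 j, (j <= n.+1)%N & c j = v.
Proof.
case=> c0 cn hc; rewrite -cn.
suff main N : (N <= n.+1)%N -> (v <= c N)%N -> exists2 j, (j <= N)%N & c j = v.
  exact: main.
elim: N => [|N IHN] leN.
  by rewrite c0 leqn0 => /eqP->; exists 0%N.
have [le _|gt le] := leqP v (c N).
  by have [j lej <-] := IHN (ltnW leN) le; exists j => //; apply: leqW.
exists N.+1 => //; apply/eqP; rewrite eqn_leq le andbT.
by have /andP[_ le2] := hc N leN; apply: leq_trans le2 gt.
Qed.

Lemma compatible_prefix M s F c : loopless M -> flat_flag M F -> rank_profile c ->
    compatible s F c -> forall j, (j <= n.+1)%N ->
  M (Defs.prefix s j) = c j /\ flag_set F (c j) = mclosure M (Defs.prefix s j).
Proof.
move=> lM ff pc /forallP hs j lej.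
have hF : is_flag F by case/andP: ff.
have ltc i : (i <= n.+1)%N -> (c i <= r.+1)%N.
  by case: (pc) => _ <- _ lei; apply: profile_mono pc _; rewrite lei leqnn.
suff [eM sub] : M (Defs.prefix s j) = c j /\ Defs.prefix s j \subset flag_set F (c j).
  split=> //; apply/esym/closure_flat => //; first exact: flag_set_flat.
  by rewrite flag_set_rk ?ltc.
elim: j lej => [_|j IHj ltj].
  by case: pc => -> _ _; rewrite prefix0 matroid_rk0 sub0set.
have [eM sub] := IHj (ltnW ltj); pose i : 'I_n.+1 := Ordinal ltj.
have /andP[s_in /implyP s_notin] := hs i.
have /andP[le1 le2] : (c j <= c j.+1 <= (c j).+1)%N by case: pc => _ _; apply.
have sub' : Defs.prefix s j.+1 \subset flag_set F (c j.+1).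
  rewrite (prefixS s i) subUset sub1set s_in.
  by apply: subset_trans sub _; apply: flag_set_mono.
split=> //; apply/eqP; rewrite eqn_leq -{1}(flag_set_rk lM ff (ltc _ ltj)) rk_mono //=.
move: le1; rewrite leq_eqVlt => /predU1P[<-|lt1].
  by rewrite -eM; apply/rk_mono/prefix_mono.
apply: leq_trans le2 _; rewrite -eM (prefixS s i).
have nin := s_notin lt1.
have ecl : mclosure M (Defs.prefix s j) = flag_set F (c j).
  apply: closure_flat => //; first exact: flag_set_flat.
  by rewrite flag_set_rk ?ltc // ltnW.
move: nin; rewrite -ecl inE => nM.
by rewrite ltn_neqAle eq_sym nM rk_mono // subsetU1.
Qed.

Lemma compatible_unique M s F F' c : loopless M -> rank_profile c ->
    flat_flag M F -> compatible s F c -> flat_flag M F' -> compatible s F' c -> F = F'.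
Proof.
move=> lM pc ff hs ff' hs'; apply/ffunP => i; apply: val_inj; rewrite -!flag_setS.
have [|j lej <-] := profile_surj pc (v := i.+1); first by rewrite ltnS ltnW.
have [_ ->] := compatible_prefix lM ff pc hs lej.
by have [_ ->] := compatible_prefix lM ff' pc hs' lej.
Qed.

Lemma compatible_ex M s c : loopless M -> rank_profile c ->
    (forall j, (j <= n.+1)%N -> M (Defs.prefix s j) = c j) ->
  exists2 F, flat_flag M F & compatible s F c.
Proof.
move=> lM pc hs.
have ex_S (i : 'I_r) : exists S : psub n, exists2 j,
    (j <= n.+1)%N /\ c j = i.+1 & val S = mclosure M (Defs.prefix s j).
  have [|j lej cj] := profile_surj pc (v := i.+1); first by rewrite ltnS ltnW.
  have rcl : M (mclosure M (Defs.prefix s j)) = i.+1 by rewrite rk_closure hs.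
  suff pS : (mclosure M (Defs.prefix s j) != set0) && (mclosure M (Defs.prefix s j) != setT).
    by exists (Sub (mclosure M (Defs.prefix s j)) pS); exists j.
  apply/andP; split; apply/eqP => e; move: rcl; rewrite e ?matroid_rk0 ?rk_setT //.
  by case=> eri; have := ltn_ord i; rewrite -eri ltnn.
have {ex_S}[f hf] := fin_all_exists ex_S.
pose F : {ffun 'I_r -> psub n} := [ffun i => f i].
have clos j j' : (j <= n.+1)%N -> (j' <= n.+1)%N -> (c j <= c j')%N ->
    mclosure M (Defs.prefix s j) \subset mclosure M (Defs.prefix s j').
  move=> lej lej' lecj; have [le|lt] := leqP j j'.
    by apply: closureS; apply: prefix_mono.
  have ec : c j = c j'.
    by apply/eqP; rewrite eqn_leq lecj profile_mono // ltnW.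
  have -> // : mclosure M (Defs.prefix s j') = mclosure M (Defs.prefix s j).
  apply: closure_flat; first exact: flat_closure.
    by apply: subset_trans (sub_closure _ _); apply/prefix_mono/ltnW.
  by rewrite rk_closure !hs.
have ff : flat_flag M F.
  apply/andP; split; last first.
    by apply/forallP => i; rewrite ffunE; have [j _ ->] := hf i; apply: flat_closure.
  apply/is_flagP => i i' lti; rewrite !ffunE.
  have [j [lej cj] ->] := hf i; have [j' [lej' cj'] ->] := hf i'.
  rewrite properE clos //=; last by rewrite cj cj' ltnS ltnW.
  apply/negP => /(rk_mono M).
  by rewrite !rk_closure !hs // cj cj' ltnS leqNgt lti.
have fsE j : (j <= n.+1)%N -> flag_set F (c j) = mclosure M (Defs.prefix s j).
  move=> lej; have [cj0|cj_gt0] := posnP (c j).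
    rewrite cj0 /=; apply/esym/eqP; apply: contraT => /(loopless_rk_gt0 lM).
    by rewrite rk_closure hs // cj0.
  have [le|gt] := leqP (c j) r; last first.
    rewrite flag_set_top //; apply/esym.
    by apply: (flat_eq (flat_closure M _)); rewrite ?subsetT // rk_closure hs // rk_setT.
  have lti : ((c j).-1 < r)%N by rewrite prednK.
  rewrite -(prednK cj_gt0) (flag_setS F (Ordinal lti)) ffunE.
  have [j' [lej' cj'] ->] := hf (Ordinal lti); rewrite /= prednK // in cj'.
  by apply/eqP; rewrite eqEsubset !clos ?cj'.
exists F => //; apply/forallP => j.
have lej : (j <= n.+1)%N := ltnW (ltn_ord j).
rewrite !fsE //; apply/andP; split.
  by apply: (subsetP (sub_closure _ _)); rewrite prefixS setU11.
by apply/implyP => ltc; rewrite inE -prefixS !hs // neq_ltn ltc orbT.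
Qed.

Definition has_profile M s c := [forall j : 'I_n.+2, M (Defs.prefix s j) == c j].

Lemma has_profileP M s c :
  reflect (forall j, (j <= n.+1)%N -> M (Defs.prefix s j) = c j) (has_profile M s c).
Proof.
apply: (iffP forallP) => h j; last by apply/eqP/h; rewrite -ltnS.
by move=> lej; apply/eqP/(h (Ordinal (lej : (j < n.+2)%N))).
Qed.

Definition weight F c := #|[set s | compatible s F c]|.

Lemma card_profile M c : loopless M -> rank_profile c ->
  #|[set s | has_profile M s c]| = (\sum_(F | flat_flag M F) weight F c)%N.
Proof.
move=> lM pc; rewrite -sum1_card big_mkcond /=.
under [RHS]eq_bigr => F _ do rewrite /weight -sum1_card big_mkcond /=.
rewrite exchange_big /=; apply: eq_bigr => s _; rewrite inE.
under eq_bigr => F _ do rewrite inE.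
case: (has_profileP M s c) => [hs|nhs].
  have [F ff hF] := compatible_ex lM pc hs.
  rewrite (bigD1 F) //= hF big1 // => F' /andP[ff' nF].
  by case: ifP => // hF'; case/eqP: nF; apply: compatible_unique lM pc ff' hF' ff hF.
rewrite big1 // => F ff; case: ifP => // hF; case: nhs => j lej.
by have [] := compatible_prefix lM ff pc hF lej.
Qed.

Lemma flag_perm F : is_flag F ->
  exists w, forall m, flag_set F m = Defs.prefix w #|flag_set F m|.
Proof.
move=> hF; have [w hw] := chain_perm (is_flag_chain hF).
exists w => -[|m]; first by rewrite cards0 prefix0.
have [lt|ge] := ltnP m r.
  by rewrite (flag_setS F (Ordinal lt)) hw // imset_f.
by rewrite flag_set_top // cardsT card_ord prefix_full.
Qed.

Lemma card_flag_set F F' m : sizes F = sizes F' -> #|flag_set F m| = #|flag_set F' m|.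
Proof.
move=> /ffunP eqs; case: m => [|m] //.
have [lt|ge] := ltnP m r; last by rewrite !flag_set_top.
rewrite !(flag_setS _ (Ordinal lt)).
by have /(congr1 (@nat_of_ord _)) := eqs (Ordinal lt); rewrite !ffunE.
Qed.

Lemma weight_sizes F F' c : is_flag F -> is_flag F' -> sizes F = sizes F' ->
  weight F c = weight F' c.
Proof.
move=> hF hF' eqs; have [w hw] := flag_perm hF; have [w' hw'] := flag_perm hF'.
pose p := (w^-1 * w')%g.
have mem_p m x : (p x \in flag_set F' m) = (x \in flag_set F m).
  rewrite hw' [in RHS]hw (card_flag_set m eqs) !in_prefix.
  by rewrite /p permM permK.
rewrite /weight -!sum1dep_card [RHS](reindex_inj (mulIg p)); apply: eq_bigl => s.
by apply: eq_forallb => j; rewrite permM !mem_p.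
Qed.

Lemma prefix_sub_compatible s F c j : is_flag F -> rank_profile c ->
  compatible s F c -> (j <= n.+1)%N -> Defs.prefix s j \subset flag_set F (c j).
Proof.
move=> hF [c0 cn hc] /forallP hs; elim: j => [_|j IHj ltj].
  by rewrite prefix0 sub0set.
have /andP[s_in _] := hs (Ordinal ltj); have /andP[le1 _] := hc j ltj.
rewrite (prefixS s (Ordinal ltj)) subUset sub1set s_in.
by apply: subset_trans (IHj (ltnW ltj)) _; apply: flag_set_mono.
Qed.

(* The rank profile whose jumps occur at position 0 and at the cardinalities k i. *)
Definition size_profile k (j : nat) := ((0 < j) + #|[set i : 'I_r | k i < j]|)%N.

Definition increasing k :=
  (forall i, 0 < k i)%N /\ (forall i j : 'I_r, (i < j)%N -> (k i < k j)%N).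

Lemma increasing_ltn k (i j : 'I_r) : increasing k -> (k i < k j)%N = (i < j)%N.
Proof.
case=> _ hk; apply/idP/idP => [|/hk//]; apply: contraLR; rewrite -!leqNgt leq_eqVlt.
by case/predU1P => [/val_inj->//|/hk/ltnW].
Qed.

Lemma card_ord_lt (i : 'I_r) : #|[set j : 'I_r | j < i]%N| = i.
Proof.
rewrite -sum1dep_card -(big_ord_widen _ (fun=> 1%N)) ?sum1_card ?card_ord //.
exact: ltnW.
Qed.

Lemma size_profileE k (i : 'I_r) : increasing k -> size_profile k (k i) = i.+1.
Proof.
move=> hk; rewrite /size_profile (proj1 hk) add1n; congr _.+1.
rewrite -[RHS]card_ord_lt; apply: eq_card => j.
by rewrite !inE increasing_ltn.
Qed.

Lemma size_profileS k j : size_profile k j.+1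
  = (size_profile k j + ((j == 0) + #|[set i | k i == j :> nat]|))%N.
Proof.
rewrite /size_profile.
have -> : [set i | (k i < j.+1)%N] = [set i | (k i < j)%N] :|: [set i | k i == j :> nat].
  by apply/setP => i; rewrite !inE ltnS leq_eqVlt orbC.
rewrite cardsU (_ : _ :&: _ = set0) ?cards0 ?subn0; last first.
  by apply/setP => i; rewrite !inE; apply/negP => /andP[lt /eqP eq]; rewrite eq ltnn in lt.
by rewrite [RHS]addnACA; case: j.
Qed.

Lemma card_fiber_le1 k (j : nat) : increasing k -> (#|[set i | k i == j :> nat]| <= 1)%N.
Proof.
move=> hk; apply/card_le1_eqP => i i'; rewrite !inE => /eqP ei /eqP ei'.
by apply/val_inj; case: (ltngtP i i') => // /(proj2 hk); rewrite ei ei' ltnn.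
Qed.

Lemma size_profile_profile k : increasing k -> rank_profile (size_profile k).
Proof.
move=> hk; split.
- by rewrite /size_profile /= eq_card0 // => i; rewrite inE.
- rewrite /size_profile add1n; congr _.+1; rewrite -[RHS]card_ord; apply: eq_card => i.
  by rewrite inE ltn_ord.
- move=> j _; rewrite size_profileS leq_addr /= -[(size_profile k j).+1]addn1 leq_add2l.
  have le1 := card_fiber_le1 j hk; case: eqP => // j0; rewrite eq_card0 // => i.
  by rewrite inE j0 eqn0Ngt (proj1 hk).
Qed.

Lemma weight_triangular F k : is_flag F -> increasing k ->
  weight F (size_profile k) != 0%N -> forall i, (k i <= sizes F i)%N.
Proof.
move=> hF hk; rewrite -lt0n => /card_gt0P[s]; rewrite inE => hs i.
have lek : (k i <= n.+1)%N := ltnW (ltn_ord _).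
have := prefix_sub_compatible hF (size_profile_profile hk) hs lek.
rewrite size_profileE // flag_setS => /subset_leq_card.
by rewrite card_prefix // ffunE.
Qed.

Lemma weight_diag F : is_flag F -> increasing (sizes F) ->
  (0 < weight F (size_profile (sizes F)))%N.
Proof.
move=> hF hk; have [w hw] := flag_perm hF; apply/card_gt0P; exists w; rewrite inE.
have wE m (j : 'I_n.+1) : (w j \in flag_set F m) = (j < #|flag_set F m|)%N.
  by rewrite {1}hw in_prefix permK.
apply/forallP => j; rewrite !wE; set k := sizes F.
have card_fs (i : 'I_r) : #|flag_set F i.+1| = k i by rewrite flag_setS ffunE.
have pk := size_profile_profile hk.
have ord_of v : (0 < v <= r)%N -> exists i : 'I_r, v = i.+1.
  by case: v => // v lt; exists (Ordinal lt).
apply/andP; split.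
  have [le|gt] := leqP (size_profile k j.+1) r; last first.
    by rewrite flag_set_top // cardsT card_ord.
  have [|i ei] := ord_of (size_profile k j.+1); first by rewrite le.
  rewrite ei card_fs ltnNge; apply/negP => lekj.
  have := profile_mono pk (i := (k i).+1) (j := j.+1).
  rewrite (ltnS (k i)) lekj => /(_ (ltn_ord j)); rewrite ei size_profileS size_profileE //.
  have /card_gt0P : exists i', i' \in [set i' | k i' == k i :> nat] by exists i; rewrite inE.
  by move=> gt0; rewrite leqNgt -[X in (X < _)%N]addn0 ltn_add2l addn_gt0 gt0 orbT.
apply/implyP; rewrite -leqNgt.
have [le|gt] := leqP (size_profile k j) r; last first.
  have := profile_mono pk (i := j.+1) (j := n.+1); rewrite leqnn andbT.
  case: pk => _ -> _ => /(_ (ltn_ord j)) le; rewrite ltnNge.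
  by rewrite (leq_trans le gt).
have [->|gt0] := posnP (size_profile k j); first by rewrite cards0.
have [|i ei] := ord_of (size_profile k j); first by rewrite gt0.
rewrite ei card_fs => ltS; rewrite leqNgt; apply/negP => ltjk.
have := profile_mono pk (i := j.+1) (j := k i).
rewrite ltjk ltnW ?ltn_ord // => /(_ isT); rewrite size_profileE //.
by rewrite leqNgt ltS.
Qed.

End CatenaryData.

Section CatenaryDetermines.
Variables (n r : nat).
Implicit Types (F : {ffun 'I_r -> psub n}) (k : {ffun 'I_r -> 'I_n.+1}) (s : 'S_n.+1).
Implicit Types (M : matroid 'I_n.+1 r.+1) (c : nat -> nat).

Definition size_weight k c :=
  if [pick F | is_flag F && (sizes F == k)] is Some F then weight F c else 0%N.

Lemma size_weightE F c : is_flag F -> size_weight (sizes F) c = weight F c.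
Proof.
move=> hF; rewrite /size_weight; case: pickP => [F' /andP[hF' /eqP]|/(_ F)].
  exact: weight_sizes.
by rewrite hF eqxx.
Qed.

Lemma card_profile_catenary M c : loopless M -> rank_profile n r c ->
  #|[set s | has_profile M s c]| = (\sum_k catenary M k * size_weight k c)%N.
Proof.
move=> lM pc; rewrite card_profile // (partition_big (@sizes n r) xpredT) //=.
apply: eq_bigr => k _; rewrite /catenary -sum1dep_card big_distrl /=.
apply: eq_bigr => F /andP[/andP[hF _] /eqP <-].
by rewrite mul1n size_weightE.
Qed.

Lemma catenary_increasing M k : catenary M k != 0%N -> increasing k.
Proof.
rewrite -lt0n => /card_gt0P[F]; rewrite inE => /andP[/andP[hF _] /eqP <-].
by split; [move=> i; rewrite ffunE psub_gt0 | apply: sizes_is_flag].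
Qed.

Lemma size_weight_triangular k k' : increasing k -> k' != k ->
  size_weight k' (size_profile k) != 0%N -> (\sum_i k i < \sum_i k' i)%N.
Proof.
move=> hk nk; rewrite /size_weight; case: pickP => // F /andP[hF /eqP eqk].
move/(weight_triangular hF hk); rewrite eqk => le_kk'.
rewrite ltn_neqAle leq_sum //= andbT; apply: contra nk => /eqP eqs.
have [_ ] := leqif_sum (fun i (_ : true) => leqif_eq (le_kk' i)).
rewrite eqs eqxx => /esym/forall_inP h; apply/eqP/ffunP => i; apply: val_inj.
by apply/esym/eqP/h.
Qed.

Lemma size_weight_diag M k : catenary M k != 0%N ->
  (0 < size_weight k (size_profile k))%N.
Proof.
move=> cat0; have := catenary_increasing cat0.
move: cat0; rewrite -lt0n => /card_gt0P[F]; rewrite inE => /andP[/andP[hF _] /eqP <-].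
by rewrite size_weightE //; apply: weight_diag.
Qed.

Lemma profiles_catenary M1 M2 : loopless M1 -> loopless M2 ->
    (forall c, rank_profile n r c ->
      #|[set s | has_profile M1 s c]| = #|[set s | has_profile M2 s c]|) ->
  forall k, catenary M1 k = catenary M2 k.
Proof.
move=> lM1 lM2 eq_prof k.
have le_sum k' : (\sum_i k' i <= r * n)%N.
  rewrite -[X in (_ <= X * _)%N](card_ord r) -sum_nat_const; apply: leq_sum => i _.
  by rewrite -ltnS ltn_ord.
have [N] := ubnP (r * n - \sum_i k i); elim: N k => // N IHN k ltN.
suff main : increasing k -> (0 < size_weight k (size_profile k))%N ->
    catenary M1 k = catenary M2 k.
  have [c1|n1] := eqVneq (catenary M1 k) 0%N; last first.
    exact: main (catenary_increasing n1) (size_weight_diag n1).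
  have [c2|n2] := eqVneq (catenary M2 k) 0%N; first by rewrite c1 c2.
  exact: main (catenary_increasing n2) (size_weight_diag n2).
move=> incr w0; have pk := size_profile_profile incr.
have := eq_prof _ pk; rewrite !card_profile_catenary // (bigD1 k) //= [RHS](bigD1 k) //=.
rewrite (eq_bigr (fun k' => catenary M2 k' * size_weight k' (size_profile k)))%N.
  by move/addIn/eqP; rewrite eqn_pmul2r // => /eqP.
move=> k' nk; have [->|nw] := eqVneq (size_weight k' (size_profile k)) 0%N.
  by rewrite !muln0.
have lt_sum := size_weight_triangular incr nk nw.
rewrite IHN // -ltnS; apply: leq_trans ltN; rewrite ltnS.
by apply: ltn_sub2l => //; apply: leq_trans lt_sum (le_sum k').
Qed.

Lemma catenary_profiles M1 M2 c : loopless M1 -> loopless M2 ->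
    (forall k, catenary M1 k = catenary M2 k) -> rank_profile n r c ->
  #|[set s | has_profile M1 s c]| = #|[set s | has_profile M2 s c]|.
Proof.
move=> lM1 lM2 eq_cat pc; rewrite !card_profile_catenary //.
by apply: eq_bigr => k _; rewrite eq_cat.
Qed.

Definition jump_profile (t : seq nat) j := sumn (take j t).

Lemma jump_profileS (t : seq nat) j : (j < size t)%N ->
  jump_profile t j.+1 = (jump_profile t j + nth 0 t j)%N.
Proof. by move=> ltj; rewrite /jump_profile (take_nth 0%N) // sumn_rcons. Qed.

Lemma sumn_count1 (t : seq nat) : all (fun x => x <= 1)%N t -> sumn t = count_mem 1%N t.
Proof. by elim: t => //= x t IHt /andP[le1 /IHt ->]; case: x le1 => [|[]]. Qed.

Lemma jump_profile_profile (t : seq01 n.+1 r.+1) : rank_profile n r (jump_profile (val t)).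
Proof.
case: t => t /= /andP[t01 /eqP ct]; have size_t := size_tuple t.
split=> [||j ltj]; first by rewrite /jump_profile take0.
  by rewrite /jump_profile take_oversize ?size_t // sumn_count1.
rewrite jump_profileS ?size_t // leq_addr /= -[X in (_ <= X)%N]addn1 leq_add2l.
by apply: (allP t01); rewrite mem_nth ?size_t.
Qed.

Lemma rank_seq_profile M s (t : seq01 n.+1 r.+1) :
  (rank_seq M s == t) = has_profile M s (jump_profile (val t)).
Proof.
have jumpE (j : 'I_n.+1) : tnth (rank_jumps M s) j
    = (M (Defs.prefix s j.+1) - M (Defs.prefix s j))%N by rewrite tnth_mktuple.
apply/eqP/has_profileP => [<- j lej|h].
  elim: j lej => [_|j IHj ltj].
    by rewrite prefix0 matroid_rk0 /jump_profile take0.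
  rewrite jump_profileS ?size_tuple // -IHj 1?ltnW //=.
  have -> : nth 0%N (rank_jumps M s) j = tnth (rank_jumps M s) (Ordinal ltj).
    by rewrite (tnth_nth 0%N).
  rewrite jumpE /= subnKC //.
  exact/rk_mono/prefix_mono.
apply/val_inj/eq_from_tnth => j /=; rewrite jumpE !h ?(ltnW (ltn_ord j)) ?ltn_ord //.
by rewrite jump_profileS ?size_tuple ?ltn_ord // addKn (tnth_nth 0%N).
Qed.

Lemma profile_jumps c : rank_profile n r c ->
  exists t : seq01 n.+1 r.+1, forall j, (j <= n.+1)%N -> jump_profile (val t) j = c j.
Proof.
move=> [c0 cn hc]; pose t := [tuple (c j.+1 - c j)%N | j < n.+1].
have t_profile j : (j <= n.+1)%N -> jump_profile t j = c j.
  elim: j => [_|j IHj ltj]; first by rewrite /jump_profile take0.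
  rewrite jump_profileS ?size_tuple // IHj 1?ltnW //.
  have -> : nth 0%N t j = tnth t (Ordinal ltj) by rewrite (tnth_nth 0%N).
  rewrite tnth_mktuple /= subnKC //.
  by have /andP[] := hc j ltj.
have t01 : all (fun x => x <= 1)%N t.
  apply/allP => x /tnthP[j ->]; rewrite tnth_mktuple leq_subLR addn1.
  by have /andP[] := hc j (ltn_ord j).
have pt : is_01_seq r.+1 t.
  rewrite /is_01_seq -sumn_count1 t01 //; apply/eqP.
  by have := t_profile _ (leqnn _); rewrite cn /jump_profile take_oversize ?size_tuple.
by exists (Sub t pt) => j lej; rewrite SubK t_profile.
Qed.

Lemma G_invariant_eqP M1 M2 : G_invariant M1 = G_invariant M2 <->
  (forall t : seq01 n.+1 r.+1,
     #|[set s | rank_seq M1 s == t]| = #|[set s | rank_seq M2 s == t]|).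
Proof.
have coeffG M (t : seq01 n.+1 r.+1) :
    coeff t (G_invariant M) = #|[set s | rank_seq M s == t]|%:R.
  rewrite /G_invariant raddf_sum /= -sum1dep_card natr_sum [RHS]big_mkcond /=.
  by apply: eq_bigr => s _; rewrite coeffU mul1r; case: eqP.
split=> [eqG t|eq_card]; last by apply/eqP/freeg_eqP => t; rewrite !coeffG eq_card.
by have := congr1 (coeff t) eqG; rewrite !coeffG => /eqP; rewrite eqr_nat => /eqP.
Qed.

Lemma G_invariant_catenary M1 M2 : loopless M1 -> loopless M2 ->
  G_invariant M1 = G_invariant M2 <-> (forall k, catenary M1 k = catenary M2 k).
Proof.
move=> lM1 lM2; rewrite G_invariant_eqP.
have card_t M (t : seq01 n.+1 r.+1) : #|[set s | rank_seq M s == t]|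
    = #|[set s | has_profile M s (jump_profile (val t))]|.
  by apply: eq_card => s; rewrite !inE rank_seq_profile.
split=> [eq_t|eq_cat t].
  apply: profiles_catenary => // c pc; have [t tc] := profile_jumps pc.
  have eq_c M : #|[set s | has_profile M s c]| = #|[set s | rank_seq M s == t]|.
    rewrite card_t; apply: eq_card => s; rewrite !inE.
    by apply/has_profileP/has_profileP => h j lej; rewrite h ?tc.
  by rewrite !eq_c.
by rewrite !card_t; apply: catenary_profiles => //; apply: jump_profile_profile.
Qed.

End CatenaryDetermines.

Section MixedEulerian.
Variables (n r : nat).
Implicit Types (M : matroid 'I_n.+1 r.+1).

Lemma matroid_class_chow_deg M (F : r.-tuple (psub n)) : loopless M -> is_chain F ->
  chow_deg (matroid_class M * chow_monomial F)
  = if all (fun S : psub n => flat M (val S)) F then 1 else 0.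
Proof.
move=> lM cF; have [gX hX] := matroid_class_spec lM; rewrite -hX // degree_map_top //.
have := chow_gradedM gX (chow_graded_monomial F).
by rewrite size_tuple subnK // (rank_le_card M).
Qed.

Lemma mixed_eulerianE M (a : 'I_n -> nat) : loopless M -> (\sum_(i < n) a i)%N = r ->
  mixed_eulerian M a
  = chow_deg (matroid_class M * \prod_(i < n) hyper n (n - i) ^+ a i).
Proof.
move=> lM sum_a; rewrite /mixed_eulerian degree_map_top //.
have [gX _] := matroid_class_spec lM.
have gL (i : 'I_n) : chow_graded (a i) (L_ n i.+1 ^+ a i).
  rewrite -[X in chow_graded X]muln1; apply: chow_gradedX.
  by apply: chow_graded_sum => S _; apply: chow_graded_x.
have := chow_gradedM gX (chow_graded_prod (index_enum 'I_n) gL).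
by rewrite sum_a subnK // (rank_le_card M).
Qed.

Lemma prod_hyper_count (s : seq nat) : all (fun m => 0 < m < n.+1)%N s ->
  (\sum_(i < n) count_mem (n - i) s)%N = size s /\
  \prod_(i < n) hyper n (n - i) ^+ count_mem (n - i)%N s = \prod_(m <- s) hyper n m.
Proof.
elim: s => [_|m s IHs /= /andP[hm /IHs[sum_s prod_s]]].
  by rewrite big_nil sum_nat_const muln0; split=> //; rewrite big1.
have lt_i : (n - m < n)%N by lia.
pose i0 := Ordinal lt_i.
have i0E (i : 'I_n) : (m == n - i)%N = (i == i0).
  by rewrite -(inj_eq val_inj) /=; have := ltn_ord i; lia.
have sub_i0 : (n - i0)%N = m by rewrite /=; lia.
split.
  rewrite big_split /= sum_s -add1n; congr (_ + _)%N.
  rewrite (eq_bigr (fun i => nat_of_bool (i == i0))) => [|i _]; last by rewrite i0E.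
  by rewrite (bigD1 i0) //= eqxx big1 // => i /negbTE ->.
under eq_bigr => i _ do rewrite exprD.
rewrite big_split /= prod_s big_cons; congr (_ * _).
rewrite (eq_bigr (fun i : 'I_n => hyper n (n - i) ^+ (i == i0))) => [|i _]; last by rewrite i0E.
rewrite (bigD1 i0) // eqxx expr1 sub_i0 big1 => [|i /andP[_ /negbTE ->]]; first exact: mulr1.
exact: expr0.
Qed.

Lemma chow_deg_level_seq M (K : seq nat) : loopless M -> sorted ltn K ->
    all (fun k => 0 < k < n.+1)%N K -> size K = r ->
  chow_deg (matroid_class M * \prod_(m <- K) level n m)
  = (catenary M [ffun i : 'I_r => inord (nth 0%N K i) : 'I_n.+1])%:R.
Proof.
move=> lM sK hK size_K; set k := [ffun _ => _].
have kE (i : 'I_r) : k i = nth 0%N K i :> nat.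
  rewrite ffunE inordK //; have := allP hK (nth 0%N K i).
  by rewrite mem_nth ?size_K // => /(_ isT) /andP[].
rewrite (big_nth 0%N) size_K big_mkord.
rewrite (eq_bigr (fun i : 'I_r => level n (k i))) => [|i _]; last by rewrite kE.
apply: chow_deg_level_catenary => [F|i j ltij]; first exact: matroid_class_chow_deg.
by rewrite !kE (sorted_ltn_nth ltn_trans) ?inE ?size_K.
Qed.

Lemma mixed_eulerian_catenary M1 M2 : loopless M1 -> loopless M2 ->
  (forall a : 'I_n -> nat, (\sum_(i < n) a i)%N = r ->
     mixed_eulerian M1 a = mixed_eulerian M2 a)
  <-> (forall k, catenary M1 k = catenary M2 k).
Proof.
move=> lM1 lM2; pose Z := matroid_class M1 - matroid_class M2.
have degZ x : chow_deg (Z * x) = chow_deg (matroid_class M1 * x) - chow_deg (matroid_class M2 * x).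
  by rewrite mulrBl raddfB.
split=> [eq_A k|eq_cat a sum_a].
  have degL K : all (fun k => 0 < k < n.+1)%N K -> size K = r ->
      chow_deg (Z * \prod_(m <- K) level n m) = 0.
    apply: chow_deg_level_prod => s hs size_s; have [sum_s <-] := prod_hyper_count hs.
    rewrite size_s in sum_s.
    by rewrite degZ -!mixed_eulerianE // eq_A // subrr.
  suff main : increasing k -> catenary M1 k = catenary M2 k.
    have [c1|n1] := eqVneq (catenary M1 k) 0%N; last exact: main (catenary_increasing n1).
    have [c2|n2] := eqVneq (catenary M2 k) 0%N; first by rewrite c1 c2.
    exact: main (catenary_increasing n2).
  move=> [k_gt0 k_incr]; pose K := [seq (k i : nat) | i <- enum 'I_r].
  have prodK : \prod_(m <- K) level n m = \prod_(i < r) level n (k i).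
    by rewrite /K big_map big_enum.
  have := degL K; rewrite size_map size_enum_ord degZ prodK.
  have HX M (lM : loopless M) F := @matroid_class_chow_deg M F lM.
  rewrite (chow_deg_level_catenary (HX _ lM1) k_incr) (chow_deg_level_catenary (HX _ lM2) k_incr).
  move=> degK; apply/eqP; rewrite -(eqr_nat rat) -subr_eq0 degK //.
  by rewrite all_map; apply/allP => i _ /=; rewrite k_gt0 ltn_ord.
apply/eqP; rewrite !mixed_eulerianE // -subr_eq0 -degZ; apply/eqP.
pose s := flatten [seq nseq (a i) (n - i)%N | i <- enum 'I_n].
have -> : \prod_(i < n) hyper n (n - i) ^+ a i = \prod_(m <- s) hyper n m.
  rewrite big_flatten big_map big_enum /=; apply: eq_bigr => i _.
  by rewrite big_nseq_cond iter_mulr_1.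
apply: (@chow_deg_hyper_prod _ r).
- move=> K uK hK size_K; have pK := permEl (perm_sort leq K).
  have sK : sorted ltn (sort leq K).
    by rewrite ltn_sorted_uniq_leq sort_uniq uK sort_sorted //; apply: leq_total.
  have {}hK : all (fun k => 0 < k < n.+1)%N (sort leq K) by rewrite all_sort.
  have {}size_K : size (sort leq K) = r by rewrite size_sort.
  by rewrite -(perm_big _ pK) degZ !chow_deg_level_seq // eq_cat subrr.
- apply/allP => m /flattenP[_ /mapP[i _ ->] /nseqP[-> _]].
  by apply: leq_trans (leq_subr _ _) _.
- rewrite size_flatten /shape -map_comp (eq_map (fun i => size_nseq (a i) (n - i)%N)).
  by rewrite sumnE big_map big_enum /= sum_a.
Qed.

End MixedEulerian.

Theorem theorem1p12 (n r : nat) (M1 M2 : matroid 'I_n.+1 r.+1)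
  (loopless1 : loopless M1) (loopless2 : loopless M2) :
  G_invariant M1 = G_invariant M2 <->
  (forall a : 'I_n -> nat, (\sum_(i < n) a i)%N = r ->
     mixed_eulerian M1 a = mixed_eulerian M2 a).
Proof.
exact: iff_trans (G_invariant_catenary loopless1 loopless2)
  (iff_sym (mixed_eulerian_catenary loopless1 loopless2)).
Qed.
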